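(* For every algebraic polytope $P$ there exists a polytope $\widehat{P}$ that is projectively unique and has a face projectively equivalent to $P$.
   Context: A polytope is algebraic if all coordinates of all its vertices are real algebraic numbers. A polytope $P\subset\mathbb{R}^d$ is projectively unique if for every polytope $P'\subset\mathbb{R}^d$ combinatorially equivalent to $P$ (isomorphic face lattices) there is a projective transformation of $\mathbb{R}^d$ (admissible on $P$) mapping $P$ onto $P'$ and realizing the given combinatorial isomorphism. Two polytopes are projectively equivalent if some admissible projective transformation maps one onto the other. *)

(* Defs.v *)
From HB Require Import structures.
From mathcomp Require Import all_boot all_order all_algebra.
From mathcomp Require Import classical_sets reals.
Set Implicit Arguments. Unset Strict Implicit. Unset Printing Implicit Defensive.
Import Order.TTheory GRing.Theory Num.Theory.
Local Open Scope ring_scope.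
Local Open Scope classical_set_scope.

Section Polytopes.
Variable R : realType.

Definition algebraic_real (x : R) : Prop :=
  exists p : {poly int}, p != 0 /\ (map_poly intr p).[x] = 0.

Definition dotv (d : nat) (a x : 'rV[R]_d) : R := \sum_(i < d) a 0 i * x 0 i.

Definition conv (d : nat) (V : seq 'rV[R]_d) : set 'rV[R]_d :=
  [set x | exists l : 'I_(size V) -> R,
     (forall i, 0 <= l i) /\ \sum_i l i = 1 /\ x = \sum_i l i *: V`_i].

Definition polytope (d : nat) (P : set 'rV[R]_d) : Prop :=
  exists V : seq 'rV[R]_d, P = conv V.

(* faces: intersections with supporting hyperplanes of valid inequalities
   a.x <= b (this includes the empty face and P itself) *)
Definition face (d : nat) (P F : set 'rV[R]_d) : Prop :=
  exists (a : 'rV[R]_d) (b : R),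
    (forall x, P x -> dotv a x <= b) /\ F = P `&` [set x | dotv a x = b].

Definition vertex (d : nat) (P : set 'rV[R]_d) (v : 'rV[R]_d) : Prop :=
  face P [set v].

Definition algebraic_polytope (d : nat) (P : set 'rV[R]_d) : Prop :=
  polytope P /\ forall v, vertex P v -> forall i, algebraic_real (v 0 i).

(* projective map x |-> (A x + b)/(c.x + delta) given by the homogeneous
   matrix M acting on row vectors (x, 1) *)
Definition proj_hom (d e : nat) (M : 'M[R]_(d + 1, e + 1)) (x : 'rV[R]_d)
  : 'rV[R]_(e + 1) := row_mx x (1 : 'rV[R]_1) *m M.

Definition proj_denom (d e : nat) (M : 'M[R]_(d + 1, e + 1)) (x : 'rV[R]_d)
  : R := rsubmx (proj_hom M x) 0 0.

Definition proj_map (d e : nat) (M : 'M[R]_(d + 1, e + 1)) (x : 'rV[R]_d)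
  : 'rV[R]_e := (proj_denom M x)^-1 *: lsubmx (proj_hom M x).

Definition admissible (d e : nat) (M : 'M[R]_(d + 1, e + 1))
  (P : set 'rV[R]_d) : Prop := forall x, P x -> proj_denom M x != 0.

Definition comb_iso (d : nat) (P Q : set 'rV[R]_d)
  (phi : set 'rV[R]_d -> set 'rV[R]_d) : Prop :=
  (forall F, face P F -> face Q (phi F)) /\
  (forall G, face Q G -> exists F, face P F /\ phi F = G) /\
  (forall F1 F2, face P F1 -> face P F2 -> (F1 `<=` F2 <-> phi F1 `<=` phi F2)).

Definition proj_unique (d : nat) (P : set 'rV[R]_d) : Prop :=
  forall (Q : set 'rV[R]_d) (phi : set 'rV[R]_d -> set 'rV[R]_d),
    polytope Q -> comb_iso P Q phi ->
    exists M : 'M[R]_(d + 1),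
      M \in unitmx /\ admissible M P /\ proj_map M @` P = Q /\
      (forall F, face P F -> proj_map M @` F = phi F).

(* projective equivalence of P in R^d with Q in R^e: an injective projective
   map (full row rank homogeneous matrix), admissible on P, mapping P onto Q.
   For d = e this is an admissible projective transformation of R^d. *)
Definition proj_equiv (d e : nat) (P : set 'rV[R]_d) (Q : set 'rV[R]_e)
  : Prop :=
  exists M : 'M[R]_(d + 1, e + 1),
    row_free M /\ admissible M P /\ proj_map M @` P = Q.

End Polytopes.

(* Main.v *)
Require Import Defs.
From mathcomp Require Import all_boot all_order all_algebra.
From mathcomp Require Import classical_sets reals.
From mathcomp Require Import boolp ring lra.

(** Embed [P] at height one in [R^(5+d)] and let [Phat] be the Lawrence polytope of the pyramid
    over it: its vertices are the apex [0], the vertices [p_i] of [P], and the pairs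
    [(+-r_j, e_j)] for a finite list of directions [r_j].  The face lattice of [Phat] records,
    for every linear form, its signs on the [r_j], so every realization of [Phat] yields a
    realization of the [r_j] with the same signs.  Von Staudt constructions by incidences make
    a suitable list rigid: a form vanishing at two coordinate vectors forces equal ratios of
    coordinates, which transports sums and products, so the value realizing an algebraic number
    is a root of the same integer polynomial, and sign conditions select the root.  Once the
    list also spans the kernels of enough forms exposing each edge from the apex to [p_i], all
    vertices are determined up to a projective transformation.  [P] is the face of [Phat]
    spanned by the [p_i]. *)
Set Implicit Arguments. Unset Strict Implicit. Unset Printing Implicit Defensive.
Import Order.TTheory GRing.Theory Num.Theory.
Local Open Scope ring_scope.

(** A Lawrence pair turns a form into a face with no convexity condition: for every [l], once [t] is
    large, [l x + sum |l(r_j)| y_j + t h] is nonnegative on [Phat]; it vanishes on both points of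
    pair [j] if [l(r_j) = 0], and otherwise on exactly one, chosen by the sign. The [p_i] are not
    doubled, as [P] has to be a face; they are seen only through forms valid on [P], hence the
    exposing forms. Transfer is one-way: a form on the [r_j] has a counterpart on the realization,
    not conversely. The frame forces the coefficients of the counterpart to have the signs of the
    original ones, in particular the same support, so forms of small support can be pinned down. Of
    the five extra coordinates, 0 and 1 serve as denominators and 2, 3, 4 as numerators, the three
    that addition uses; coordinate 0 also carries the height of [P], and coordinate 2, zero on [P],
    gives the exposing forms a coefficient 1 to normalize by. *)

Section DotProduct.
Variable R : realType.
Implicit Types n m : nat.

Lemma dotvC n (a x : 'rV[R]_n) : dotv a x = dotv x a.
Proof. by apply: eq_bigr => i _; rewrite mulrC. Qed.

Lemma dotvDr n (a x y : 'rV[R]_n) : dotv a (x + y) = dotv a x + dotv a y.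
Proof. by rewrite -big_split; apply: eq_bigr => i _; rewrite mxE mulrDr. Qed.

Lemma dotvZr n c (a x : 'rV[R]_n) : dotv a (c *: x) = c * dotv a x.
Proof. by rewrite [RHS]mulr_sumr; apply: eq_bigr => i _; rewrite mxE mulrCA. Qed.

Lemma dotv0r n (a : 'rV[R]_n) : dotv a 0 = 0.
Proof. by apply: big1 => i _; rewrite mxE mulr0. Qed.

Lemma dotvNr n (a x : 'rV[R]_n) : dotv a (- x) = - dotv a x.
Proof. by rewrite -scaleN1r dotvZr mulN1r. Qed.

Lemma dotvBr n (a x y : 'rV[R]_n) : dotv a (x - y) = dotv a x - dotv a y.
Proof. by rewrite dotvDr dotvNr. Qed.

Lemma dotv_sumr n (I : Type) (s : seq I) (P : pred I) (a : 'rV[R]_n) (F : I -> 'rV[R]_n) :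
  dotv a (\sum_(i <- s | P i) F i) = \sum_(i <- s | P i) dotv a (F i).
Proof. exact: (big_morph (dotv a) (dotvDr a) (dotv0r a)). Qed.

Lemma dotvDl n (a b x : 'rV[R]_n) : dotv (a + b) x = dotv a x + dotv b x.
Proof. by rewrite !(dotvC _ x) dotvDr. Qed.

Lemma dotvZl n c (a x : 'rV[R]_n) : dotv (c *: a) x = c * dotv a x.
Proof. by rewrite !(dotvC _ x) dotvZr. Qed.

Lemma dotv0l n (x : 'rV[R]_n) : dotv 0 x = 0.
Proof. by rewrite dotvC dotv0r. Qed.

Lemma dotvNl n (a x : 'rV[R]_n) : dotv (- a) x = - dotv a x.
Proof. by rewrite !(dotvC _ x) dotvNr. Qed.

Lemma dotvBl n (a b x : 'rV[R]_n) : dotv (a - b) x = dotv a x - dotv b x.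
Proof. by rewrite !(dotvC _ x) dotvBr. Qed.

Lemma dotv_deltar n (a : 'rV[R]_n) i : dotv a (delta_mx 0 i) = a 0 i.
Proof.
rewrite /dotv (bigD1 i) //= mxE !eqxx mulr1 big1 ?addr0 // => j ji.
by rewrite mxE (negPf ji) mulr0.
Qed.

Lemma dotv_deltal n (x : 'rV[R]_n) i : dotv (delta_mx 0 i) x = x 0 i.
Proof. by rewrite dotvC dotv_deltar. Qed.

Lemma dotv_row_mx n m (a x : 'rV[R]_n) (b y : 'rV[R]_m) :
  dotv (row_mx a b) (row_mx x y) = dotv a x + dotv b y.
Proof.
by rewrite /dotv big_split_ord; congr (_ + _); apply: eq_bigr => i _;
  rewrite ?row_mxEl ?row_mxEr.
Qed.

Lemma dotv_mulmx n m (a : 'rV[R]_m) (x : 'rV[R]_n) (M : 'M[R]_(n, m)) :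
  dotv a (x *m M) = dotv (a *m M^T) x.
Proof.
rewrite /dotv (eq_bigr (fun i => \sum_j a 0 i * (x 0 j * M j i))); last first.
  by move=> i _; rewrite mxE mulr_sumr.
rewrite exchange_big; apply: eq_bigr => j _; rewrite mxE mulr_suml.
by apply: eq_bigr => i _; rewrite mxE mulrA mulrAC.
Qed.

Lemma dotvv_eq0 n (x : 'rV[R]_n) : (dotv x x == 0) = (x == 0).
Proof.
apply/eqP/eqP => [/eqP|->]; last exact: dotv0r.
rewrite psumr_eq0 => [/allP x0|i _]; last by rewrite -expr2 sqr_ge0.
apply/rowP => i; rewrite mxE; apply/eqP.
by have := x0 i (mem_index_enum i); rewrite /= mulf_eq0 orbb.
Qed.

Lemma dotvv_ge0 n (x : 'rV[R]_n) : 0 <= dotv x x.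
Proof. by apply: sumr_ge0 => i _; rewrite -expr2 sqr_ge0. Qed.

End DotProduct.

(** * Rigid lists of directions *)
Section RigidLists.
Variable R : realType.
Variable d : nat.
Notation k := (5 + d)%N.
Notation vec := 'rV[R]_k.
Implicit Types (x y z : R) (r s v w : vec) (l : vec) (L : seq vec) (rho : vec -> vec).

(** Directions count only up to positive scaling, so rigidity is a statement about rays. *)
Definition fixes rho r := exists2 c : R, 0 < c & rho r = c *: r.

(** A projective frame: a linear map preserving these rays is a positive multiple of the
    identity. *)
Definition frame : seq vec := const_mx 1 :: [seq delta_mx 0 i | i : 'I_k].

(** In oriented matroid terms, covectors of [L] remain covectors of its image; this is what the
    faces of a Lawrence polytope guarantee. *)
Definition tracks L rho :=
  forall l, exists l', forall r, r \in L -> Num.sg (dotv l' (rho r)) = Num.sg (dotv l r).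

Definition normalized L rho :=
  tracks (frame ++ L) rho /\ forall r, r \in frame -> fixes rho r.

Definition rigid L := forall rho, normalized L rho -> forall r, r \in L -> fixes rho r.

Lemma delta_frame i : (delta_mx 0 i : vec) \in frame.
Proof. by rewrite inE map_f ?orbT // mem_enum. Qed.

Lemma normalized_sub L1 L2 rho : {subset L1 <= L2} -> normalized L2 rho -> normalized L1 rho.
Proof.
move=> sub [tr fr]; split=> // l; have [l' l'P] := tr l; exists l' => r.
rewrite mem_cat => /orP[rL|/sub rL]; apply: l'P; rewrite mem_cat rL ?orbT //.
Qed.

Lemma rigid_cat L1 L2 : rigid L1 -> rigid L2 -> rigid (L1 ++ L2).
Proof.
move=> h1 h2 rho nr r; rewrite mem_cat => /orP[] rL; [apply: h1|apply: h2] => //;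
  by apply: normalized_sub nr => z zL; rewrite mem_cat zL ?orbT.
Qed.

Lemma frame_neq0 v : v \in frame -> v != 0.
Proof.
rewrite inE => /orP[/eqP->|/mapP[i _ ->]]; apply/eqP => /rowP.
  by move=> /(_ ord0); rewrite !mxE => /eqP; rewrite oner_eq0.
by move=> /(_ i); rewrite !mxE !eqxx => /eqP; rewrite oner_eq0.
Qed.

(** Once 0 is dropped from the list, [rho] is unconstrained there; redefining it as 0 at that point
    restores tracking. Nonzero directions keep the two points of a Lawrence pair distinct. *)
Lemma rigid_filter L : rigid L -> rigid [seq r <- L | r != 0].
Proof.
move=> h rho [tr fr] r; rewrite mem_filter => /andP[r0 rL].
pose rho' v := if v == 0 then 0 else rho v.
have : fixes rho' r.
  apply: h => //; split=> [l|v vf]; last by rewrite /fixes /rho' (negPf (frame_neq0 vf)); exact: fr.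
  have [l' l'P] := tr l; exists l' => v vL; rewrite /rho'.
  case: eqP => [->|/eqP v0]; first by rewrite !dotv0r.
  by apply: l'P; move: vL; rewrite !mem_cat mem_filter v0.
by rewrite /fixes /rho' (negPf r0).
Qed.

(** * Forms with few nonzero coefficients under a normalized map *)

Section Normalized.
Variables (L : seq vec) (rho : vec -> vec).
Hypothesis nrho : normalized L rho.
Let FL := frame ++ L.

(** Evaluate at the basis vectors, whose rays are fixed. *)
Lemma tracks_delta l l' : (forall r, r \in FL -> Num.sg (dotv l' (rho r)) = Num.sg (dotv l r)) ->
  forall j, Num.sg (l' 0 j) = Num.sg (l 0 j).
Proof.
move=> l'P j; have dj := delta_frame j; have [c c0 rj] := nrho.2 _ dj.
have := l'P (delta_mx 0 j); rewrite mem_cat dj rj => /(_ isT).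
by rewrite dotvZr sgrM (gtr0_sg c0) mul1r !dotv_deltar.
Qed.

Lemma sg_coord r i : r \in FL -> Num.sg (rho r 0 i) = Num.sg (r 0 i).
Proof.
move=> rL; have [l' l'P] := nrho.1 (delta_mx 0 i).
have l'd := tracks_delta l'P; have := l'P r rL; rewrite dotv_deltal => <-.
rewrite /dotv (bigD1 i) //= big1 => [|j ji]; last first.
  by have /eqP := l'd j; rewrite mxE (negPf ji) andbF sgr0 sgr_eq0 => /eqP->; rewrite mul0r.
by rewrite addr0 sgrM l'd mxE !eqxx sgr1 mul1r.
Qed.

(** The counterpart of [x_b - x x_a] is supported on [a], [b] and positive at [b], so up to scaling
    it has the same shape. Since [x'] is independent of [r], equal ratios have equal images. *)
Lemma ratio_transfer a b x : a != b -> exists x', forall r, r \in FL ->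
  Num.sg (rho r 0 b - x' * rho r 0 a) = Num.sg (r 0 b - x * r 0 a).
Proof.
move=> ab; have [l' l'P] := nrho.1 (delta_mx 0 b - x *: delta_mx 0 a).
have l'd := tracks_delta l'P.
have lb : 0 < l' 0 b.
  by rewrite -sgr_gt0 l'd !mxE !eqxx eq_sym (negPf ab) mulr0 subr0 sgr1.
have lj j : j != b -> j != a -> l' 0 j = 0.
  move=> jb ja; apply/eqP; rewrite -sgr_eq0 l'd !mxE (negPf ja) (negPf jb).
  by rewrite !andbF mulr0 subr0 sgr0.
exists (- (l' 0 a / l' 0 b)) => r rL; have := l'P r rL.
rewrite dotvBl dotvZl !dotv_deltal => <-.
rewrite [in RHS]/dotv (bigD1 b) //= (bigD1 a) //= big1 => [|j /andP[jb ja]]; last by rewrite lj ?mul0r.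
rewrite -[LHS]mul1r -(gtr0_sg lb) -sgrM addr0; congr Num.sg.
by field; rewrite gt_eqF.
Qed.

(** For the ratio 1, the all-ones vector of the frame forces [x' = 1]. *)
Lemma eq_coord r a b : r \in FL -> r 0 a = r 0 b -> rho r 0 a = rho r 0 b.
Proof.
have [->//|ab rL rab] := eqVneq a b.
have [x' h] := ratio_transfer 1 ab.
have x1 : x' = 1.
  have f1 : (const_mx 1 : vec) \in frame by rewrite mem_head.
  have [c c0 rc] := nrho.2 _ f1.
  have f1L : const_mx 1 \in FL by rewrite mem_cat f1.
  have /eqP := h _ f1L; rewrite rc !mxE !mulr1 subrr sgr0.
  rewrite sgr_eq0 subr_eq0 => /eqP; rewrite -[LHS]mul1r => /mulIf; rewrite gt_eqF // => ->//.
have /eqP := h r rL; rewrite x1 !mul1r rab subrr sgr0 sgr_eq0 subr_eq0 => /eqP//.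
Qed.

Lemma fixes_coord r a : r \in FL -> r 0 a = 1 ->
  (forall b, rho r 0 b = r 0 b * rho r 0 a) -> fixes rho r.
Proof.
move=> rL ra h; exists (rho r 0 a); first by rewrite -sgr_gt0 sg_coord // ra sgr1.
by apply/rowP => b; rewrite h mxE mulrC.
Qed.

Lemma coord0 r a : r \in FL -> r 0 a = 0 -> rho r 0 a = 0.
Proof. by move=> rL ra; apply/eqP; rewrite -sgr_eq0 sg_coord // ra sgr0. Qed.

End Normalized.

Notation i0 := (@Ordinal k 0 isT).
Notation i1 := (@Ordinal k 1 isT).
Notation i2 := (@Ordinal k 2 isT).
Notation i3 := (@Ordinal k 3 isT).
Notation i4 := (@Ordinal k 4 isT).

(* Encodes [x] as the ratio of any coordinate of index >= 2 to coordinate 0 or 1. *)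
Definition scalar_vec x : vec := \row_i (if (i < 2)%N then 1 else x).

Definition val rho x := rho (scalar_vec x) 0 i2 / rho (scalar_vec x) 0 i0.

Definition list_vec (s : seq R) : vec := \row_i s`_i.

Section Values.
Variables (L : seq vec) (rho : vec -> vec).
Hypothesis nrho : normalized L rho.
Let FL := frame ++ L.

Lemma scalar_vec0_gt0 x : scalar_vec x \in FL -> 0 < rho (scalar_vec x) 0 i0.
Proof. by move=> xL; rewrite -sgr_gt0 (sg_coord nrho) // mxE sgr1. Qed.

(** The transferred ratio can be read off [scalar_vec x]. Its coordinates below 2 have equal images,
    and so do those from 2 on, so one value serves all pairs of a denominator [a] and a numerator
    [b]. *)
Lemma ratio_val x r (a b : 'I_k) : scalar_vec x \in FL -> r \in FL ->
  (a < 2 <= b)%N -> r 0 b = x * r 0 a -> rho r 0 b = val rho x * rho r 0 a.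
Proof.
move=> xL rL /andP[a2 b2] rab.
have ab : a != b by apply: contraTneq b2 => <-; rewrite -ltnNge.
have [x' h] := ratio_transfer nrho x ab.
have ea : rho (scalar_vec x) 0 a = rho (scalar_vec x) 0 i0.
  by apply: (eq_coord nrho) => //; rewrite !mxE a2.
have eb : rho (scalar_vec x) 0 b = rho (scalar_vec x) 0 i2.
  by apply: (eq_coord nrho) => //; rewrite !mxE ltnNge b2.
have -> : val rho x = x'.
  have /eqP := h _ xL; rewrite !mxE a2 ltnNge b2 mulr1 subrr sgr0 sgr_eq0 subr_eq0 ea eb => /eqP.
  by rewrite /val => ->; rewrite mulfK // gt_eqF // scalar_vec0_gt0.
by have /eqP := h _ rL; rewrite rab subrr sgr0 sgr_eq0 subr_eq0 => /eqP.
Qed.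

Lemma sg_val x : scalar_vec x \in FL -> Num.sg (val rho x) = Num.sg x.
Proof.
move=> xL; rewrite /val sgrM sgrV (gtr0_sg (scalar_vec0_gt0 xL)) mulr1.
by rewrite (sg_coord nrho) // mxE.
Qed.

Lemma val1 : val rho 1 = 1.
Proof.
have f1 : (const_mx 1 : vec) \in frame by rewrite mem_head.
have -> : val rho 1 = val rho 1 * 1 by rewrite mulr1.
rewrite /val; have -> : scalar_vec 1 = const_mx 1 by apply/rowP => i; rewrite !mxE if_same.
have [c c0 ->] := nrho.2 _ f1; rewrite !mxE !mulr1 divff // gt_eqF //.
Qed.

Lemma fixes_scalar_vec x : scalar_vec x \in FL -> val rho x = x -> fixes rho (scalar_vec x).
Proof.
move=> xL vx; apply: (fixes_coord nrho (a := i0)) => //; first by rewrite mxE.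
move=> b; rewrite mxE; case: ltnP => b2.
  by rewrite mul1r; apply: (eq_coord nrho) => //; rewrite !mxE b2.
by rewrite (ratio_val (x := x) (a := i0)) ?vx // ?b2 // !mxE ltnNge b2 mulr1.
Qed.

End Values.

(* The last two vectors make the form x2 + x3 - x4, which vanishes on the fourth one, rigid. *)
Definition add_list x y := [:: scalar_vec x; scalar_vec y; scalar_vec (x + y);
  list_vec [:: 1; 1; x; y; x + y];
  delta_mx 0 i2 + delta_mx 0 i4; delta_mx 0 i3 + delta_mx 0 i4].

(* The coordinate pairs (0, 2), (1, 3), (0, 3) of the last vector have ratios y, x, x * y,
   and its coordinates 1 and 2 agree. *)
Definition mul_list x y := [:: scalar_vec x; scalar_vec y; scalar_vec (x * y);
  list_vec [:: 1; y; y; x * y]].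

Lemma delta_addE (a b c : 'I_k) :
  (delta_mx 0 a + delta_mx 0 b : vec) 0 c = (c == a)%:R + (c == b)%:R.
Proof. by rewrite !mxE. Qed.

Lemma fixes_delta_add L rho (a b : 'I_k) : normalized L rho -> a != b ->
  (delta_mx 0 a + delta_mx 0 b : vec) \in frame ++ L ->
  fixes rho (delta_mx 0 a + delta_mx 0 b).
Proof.
move=> nrho ab rL; apply: (fixes_coord nrho (a := a)) => // [|c].
  by rewrite delta_addE eqxx (negPf ab) addr0.
rewrite delta_addE; have [->|ca] := eqVneq c a.
  by rewrite (negPf ab) addr0 mul1r.
have [->|cb] := eqVneq c b.
  rewrite add0r mul1r; apply: (eq_coord nrho) => //.
  by rewrite !delta_addE !eqxx (negPf ab) eq_sym (negPf ab) addrC.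
by rewrite addr0 mul0r (coord0 nrho) // delta_addE (negPf ca) (negPf cb) addr0.
Qed.

(** * Addition and multiplication forced by incidences *)

Section Arithmetic.
Variables (L : seq vec) (rho : vec -> vec).
Hypothesis nrho : normalized L rho.

Let inFL r : r \in L -> r \in frame ++ L.
Proof. by move=> rL; rewrite mem_cat rL orbT. Qed.

Lemma val_add x y : {subset add_list x y <= L} -> val rho (x + y) = val rho x + val rho y.
Proof.
move=> sub; have inL r : r \in add_list x y -> r \in frame ++ L by move=> /sub/inFL.
have [xL yL xyL] : [/\ scalar_vec x \in frame ++ L, scalar_vec y \in frame ++ L
    & scalar_vec (x + y) \in frame ++ L] by split; apply: inL; rewrite !inE eqxx ?orbT.
set v := list_vec [:: 1; 1; x; y; x + y].
have vL : v \in frame ++ L by apply: inL; rewrite !inE eqxx ?orbT.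
have uL : (delta_mx 0 i2 + delta_mx 0 i4 : vec) \in frame ++ L by apply: inL; rewrite !inE eqxx ?orbT.
have wL : (delta_mx 0 i3 + delta_mx 0 i4 : vec) \in frame ++ L by apply: inL; rewrite !inE eqxx ?orbT.
(* Signs give [l'] the support of [l], and vanishing on the two fixed sums gives it the right
   proportions; evaluated at the image of [v] it then reads as additivity of [val]. *)
pose l : vec := delta_mx 0 i2 + delta_mx 0 i3 - delta_mx 0 i4.
have [l' l'P] := nrho.1 l; have l'd := tracks_delta nrho l'P.
have l'0 r : fixes rho r -> r \in frame ++ L -> dotv l r = 0 -> dotv l' r = 0.
  move=> [c c0 rc] rL lr; have /eqP := l'P r rL.
  by rewrite rc lr sgr0 dotvZr sgr_eq0 mulf_eq0 gt_eqF //= => /eqP.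
have l24 : l' 0 i2 + l' 0 i4 = 0.
  rewrite -!dotv_deltar -dotvDr; apply: l'0 => //; first exact: fixes_delta_add nrho _ uL.
  by rewrite dotvDr !dotv_deltar !mxE /=; ring.
have l34 : l' 0 i3 + l' 0 i4 = 0.
  rewrite -!dotv_deltar -dotvDr; apply: l'0 => //; first exact: fixes_delta_add nrho _ wL.
  by rewrite dotvDr !dotv_deltar !mxE /=; ring.
have lE j : l 0 j = (j == i2)%:R + (j == i3)%:R - (j == i4)%:R by rewrite !mxE.
have l2 : 0 < l' 0 i2 by rewrite -sgr_gt0 l'd lE /= subr0 addr0 sgr1.
have l'E : l' = l' 0 i2 *: l.
  apply/rowP => j; rewrite [RHS]mxE lE.
  have [->|j2] := eqVneq j i2; first by rewrite /= subr0 addr0 mulr1.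
  have [->|j3] := eqVneq j i3.
    rewrite /= subr0 add0r mulr1.
    by apply: (addIr (l' 0 i4)); rewrite l24 l34.
  have [->|j4] := eqVneq j i4.
    by rewrite /= !add0r mulrN1; apply/eqP; rewrite -addr_eq0 addrC l24.
  apply/eqP; rewrite !addr0 subr0 mulr0 -sgr_eq0.
  by rewrite l'd lE (negPf j2) (negPf j3) (negPf j4) !addr0 subr0 sgr0.
have := l'P v vL; rewrite l'E dotvZl sgrM (gtr0_sg l2) mul1r dotvBl dotvDl !dotv_deltal.
rewrite dotvBl dotvDl !dotv_deltal !mxE /= subrr sgr0 => /eqP; rewrite sgr_eq0.
rewrite (ratio_val nrho xL vL (a := i0) (b := i2)) ?mxE ?mulr1 //.
rewrite (ratio_val nrho yL vL (a := i0) (b := i3)) ?mxE ?mulr1 //.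
rewrite (ratio_val nrho xyL vL (a := i0) (b := i4)) ?mxE ?mulr1 //.
have v0 : 0 < rho v 0 i0 by rewrite -sgr_gt0 (sg_coord nrho) // mxE sgr1.
by rewrite -mulrDl -mulrBl mulf_eq0 (gt_eqF v0) orbF subr_eq0 => /eqP->.
Qed.

Lemma val_mul x y : {subset mul_list x y <= L} -> val rho (x * y) = val rho x * val rho y.
Proof.
move=> sub; have inL r : r \in mul_list x y -> r \in frame ++ L by move=> /sub/inFL.
have [xL yL xyL] : [/\ scalar_vec x \in frame ++ L, scalar_vec y \in frame ++ L
    & scalar_vec (x * y) \in frame ++ L] by split; apply: inL; rewrite !inE eqxx ?orbT.
set v := list_vec [:: 1; y; y; x * y].
have vL : v \in frame ++ L by apply: inL; rewrite !inE eqxx ?orbT.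
have v0 : 0 < rho v 0 i0 by rewrite -sgr_gt0 (sg_coord nrho) // mxE sgr1.
have e3 : rho v 0 i3 = val rho (x * y) * rho v 0 i0.
  by rewrite (ratio_val nrho xyL vL (a := i0)) // !mxE /= mulr1.
have e2 : rho v 0 i2 = val rho y * rho v 0 i0.
  by rewrite (ratio_val nrho yL vL (a := i0)) // !mxE /= mulr1.
have e1 : rho v 0 i1 = rho v 0 i2 by apply: (eq_coord nrho) => //; rewrite !mxE.
have e13 : rho v 0 i3 = val rho x * rho v 0 i1.
  by rewrite (ratio_val nrho xL vL (a := i1)) // !mxE.
by apply: (mulIf (lt0r_neq0 v0)); rewrite -e3 e13 e1 e2 mulrA.
Qed.

Lemma fixes_add_list x y : {subset add_list x y <= L} ->
  val rho x = x -> val rho y = y -> forall r, r \in add_list x y -> fixes rho r.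
Proof.
move=> sub vx vy; have vxy : val rho (x + y) = x + y by rewrite val_add // vx vy.
have inL r : r \in add_list x y -> r \in frame ++ L by move=> /sub/inFL.
have [xL yL xyL] : [/\ scalar_vec x \in frame ++ L, scalar_vec y \in frame ++ L
    & scalar_vec (x + y) \in frame ++ L] by split; apply: inL; rewrite !inE eqxx ?orbT.
have rL : list_vec [:: 1; 1; x; y; x + y] \in frame ++ L by apply: inL; rewrite !inE eqxx ?orbT.
have rf : fixes rho (list_vec [:: 1; 1; x; y; x + y]).
  apply: (fixes_coord nrho (a := i0)) => //; first by rewrite mxE.
  move=> b; case: (ltnP b 2) => b2.
    have -> : list_vec [:: 1; 1; x; y; x + y] 0 b = 1 by rewrite mxE; case: b b2 => [[|[]]].
    by rewrite mul1r; apply: (eq_coord nrho) => //; rewrite !mxE; case: b b2 => [[|[]]].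
  have [->|b2'] := eqVneq b i2; first by rewrite (ratio_val nrho xL rL (a := i0)) ?vx ?mxE /= ?mulr1.
  have [->|b3'] := eqVneq b i3; first by rewrite (ratio_val nrho yL rL (a := i0)) ?vy ?mxE /= ?mulr1.
  have [->|b4'] := eqVneq b i4; first by rewrite (ratio_val nrho xyL rL (a := i0)) ?vxy ?mxE /= ?mulr1.
  have b0 : list_vec [:: 1; 1; x; y; x + y] 0 b = 0.
    by rewrite mxE nth_default //=; case: b b2 b2' b3' b4' => [[|[|[|[|[|b]]]]]].
  by rewrite b0 mul0r (coord0 nrho).
move=> r; rewrite !inE.
do 4![case/predU1P => [->|]; first by [|apply: (fixes_scalar_vec nrho)]].
by case/orP => /eqP->; apply: (fixes_delta_add nrho) => //; apply: inL; rewrite !inE eqxx ?orbT.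
Qed.

Lemma fixes_mul_list x y : {subset mul_list x y <= L} ->
  val rho x = x -> val rho y = y -> forall r, r \in mul_list x y -> fixes rho r.
Proof.
move=> sub vx vy; have vxy : val rho (x * y) = x * y by rewrite val_mul // vx vy.
have inL r : r \in mul_list x y -> r \in frame ++ L by move=> /sub/inFL.
have [xL yL xyL] : [/\ scalar_vec x \in frame ++ L, scalar_vec y \in frame ++ L
    & scalar_vec (x * y) \in frame ++ L] by split; apply: inL; rewrite !inE eqxx ?orbT.
have rL : list_vec [:: 1; y; y; x * y] \in frame ++ L by apply: inL; rewrite !inE eqxx ?orbT.
have rf : fixes rho (list_vec [:: 1; y; y; x * y]).
  apply: (fixes_coord nrho (a := i0)) => //; first by rewrite mxE.
  have h2 : rho (list_vec [:: 1; y; y; x * y]) 0 i2 = y * rho (list_vec [:: 1; y; y; x * y]) 0 i0.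
    by rewrite (ratio_val nrho yL rL (a := i0)) ?vy ?mxE /= ?mulr1.
  move=> b; have [->|b0'] := eqVneq b i0; first by rewrite mxE mul1r.
  have [->|b1'] := eqVneq b i1.
    by rewrite mxE /= -h2; apply: (eq_coord nrho) => //; rewrite !mxE.
  have [->|b2'] := eqVneq b i2; first by rewrite mxE.
  have [->|b3'] := eqVneq b i3; first by rewrite (ratio_val nrho xyL rL (a := i0)) ?vxy ?mxE /= ?mulr1.
  have b0 : list_vec [:: 1; y; y; x * y] 0 b = 0.
    by rewrite mxE nth_default //=; case: b b0' b1' b2' b3' => [[|[|[|[|b]]]]].
  by rewrite b0 mul0r (coord0 nrho).
move=> r; rewrite !inE.
do 3![case/predU1P => [->|]; first exact: (fixes_scalar_vec nrho)].
by move/eqP->.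
Qed.

End Arithmetic.
(** The list may depend on [a], yet it forces the relation at whatever value the realization assigns
    to [a]. The last clause says that the auxiliary vectors bring no freedom of their own. *)
Definition computable a (f : R -> R) := exists L,
  [/\ scalar_vec a \in L, scalar_vec (f a) \in L & forall rho, normalized L rho ->
    val rho (f a) = f (val rho a) /\ (val rho a = a -> forall r, r \in L -> fixes rho r)].

Lemma val_fixed rho x : fixes rho (scalar_vec x) -> val rho x = x.
Proof. by move=> [c c0 rc]; rewrite /val rc !mxE /= mulr1 mulrAC divff ?mul1r // gt_eqF. Qed.

Lemma computable_id a : computable a id.
Proof.
exists [:: scalar_vec a]; rewrite mem_head; split=> // rho nrho; split=> // va r.
rewrite inE => /eqP->; apply: (fixes_scalar_vec nrho) => //.
by rewrite mem_cat mem_head orbT.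
Qed.

Lemma computable1 a : computable a (fun=> 1).
Proof.
exists [:: scalar_vec a; scalar_vec 1]; rewrite !inE !eqxx ?orbT; split=> // rho nrho.
have v1 := val1 nrho; split=> // va r.
by rewrite !inE => /orP[]/eqP->; apply: (fixes_scalar_vec nrho) => //;
  rewrite mem_cat !inE eqxx ?orbT.
Qed.

Lemma computableD a f g : computable a f -> computable a g -> computable a (fun x => f x + g x).
Proof.
move=> [L1 [a1 f1 h1]] [L2 [a2 f2 h2]]; pose A := add_list (f a) (g a).
exists (L1 ++ L2 ++ A); rewrite !mem_cat a1 !inE eqxx ?orbT; split=> // rho nrho.
have [] := h1 rho; first by apply: normalized_sub nrho => r rL; rewrite !mem_cat rL.
move=> vf r1.
have [] := h2 rho; first by apply: normalized_sub nrho => r rL; rewrite !mem_cat rL ?orbT.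
move=> vg r2.
have sA : {subset A <= L1 ++ L2 ++ A} by move=> r rL; rewrite !mem_cat rL ?orbT.
split=> [|va r]; first by rewrite (val_add nrho) ?vf ?vg.
rewrite !mem_cat => /or3P[/(r1 va)//|/(r2 va)//|].
by apply: (fixes_add_list nrho) => //; rewrite ?vf ?vg ?va.
Qed.

Lemma computableM a f g : computable a f -> computable a g -> computable a (fun x => f x * g x).
Proof.
move=> [L1 [a1 f1 h1]] [L2 [a2 f2 h2]]; pose A := mul_list (f a) (g a).
exists (L1 ++ L2 ++ A); rewrite !mem_cat a1 !inE eqxx ?orbT; split=> // rho nrho.
have [] := h1 rho; first by apply: normalized_sub nrho => r rL; rewrite !mem_cat rL.
move=> vf r1.
have [] := h2 rho; first by apply: normalized_sub nrho => r rL; rewrite !mem_cat rL ?orbT.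
move=> vg r2.
have sA : {subset A <= L1 ++ L2 ++ A} by move=> r rL; rewrite !mem_cat rL ?orbT.
split=> [|va r]; first by rewrite (val_mul nrho) ?vf ?vg.
rewrite !mem_cat => /or3P[/(r1 va)//|/(r2 va)//|].
by apply: (fixes_mul_list nrho) => //; rewrite ?vf ?vg ?va.
Qed.

(** The sum of [x] and [- x] is 0, whose value has sign 0, so additivity applies. *)
Lemma val_opp L rho x : normalized L rho -> {subset add_list x (- x) <= L} ->
  val rho (- x) = - val rho x.
Proof.
move=> nrho sub; apply/eqP; rewrite -addr_eq0 addrC -(val_add nrho) // -sgr_eq0.
rewrite (sg_val nrho) ?subrr ?sgr0 // mem_cat.
have -> : scalar_vec 0 = scalar_vec (x + - x) by rewrite subrr.
by rewrite sub ?orbT // !inE eqxx ?orbT.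
Qed.

Lemma computableN a f : computable a f -> computable a (fun x => - f x).
Proof.
move=> [L1 [a1 f1 h1]]; pose A := add_list (f a) (- f a).
exists (L1 ++ A); rewrite !mem_cat a1 !inE eqxx ?orbT; split=> // rho nrho.
have [] := h1 rho; first by apply: normalized_sub nrho => r rL; rewrite !mem_cat rL.
move=> vf r1.
have sA : {subset A <= L1 ++ A} by move=> r rL; rewrite !mem_cat rL ?orbT.
have vN := val_opp nrho sA.
split=> [|va r]; first by rewrite vN vf.
rewrite !mem_cat => /orP[/(r1 va)//|].
by apply: (fixes_add_list nrho) => //; rewrite ?vN ?vf ?va.
Qed.

Lemma computable0 a : computable a (fun=> 0).
Proof.
have := computableD (computable1 a) (computableN (computable1 a)).
by rewrite (_ : (fun x => _) = fun=> 0) //; apply/funext => x; rewrite subrr.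
Qed.

Lemma computable_int a (c : int) : computable a (fun=> c%:~R).
Proof.
have nat_case n : computable a (fun=> n%:R).
  elim: n => [|n IHn]; first exact: computable0.
  have := computableD (computable1 a) IHn.
  by rewrite (_ : (fun x => _) = fun=> n.+1%:R) //; apply/funext => x; rewrite mulrS.
case: c => n; first exact: nat_case.
have := computableN (nat_case n.+1).
by rewrite (_ : (fun x => _) = fun=> (Negz n)%:~R) //; apply/funext => x; rewrite NegzE mulrNz.
Qed.

Lemma computable_poly a (p : {poly int}) : computable a (fun x => (map_poly intr p).[x]).
Proof.
elim/poly_ind: p => [|p c IHp].
  by rewrite rmorph0 (_ : (fun x => _) = fun=> 0) //; [exact: computable0|apply/funext => x; rewrite horner0].
have := computableD (computableM IHp (computable_id a)) (computable_int a c).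
rewrite (_ : (fun x => _) = fun x => (map_poly intr (p * 'X + c%:P)).[x]) //.
by apply/funext => x; rewrite rmorphD rmorphM /= map_polyX map_polyC /= hornerMXaddC.
Qed.

Lemma finite_roots (p : {poly R}) : p != 0 -> exists s : seq R, forall x, root p x -> x \in s.
Proof.
have [n] := ubnP (size p); elim: n p => // n IHn p pn p0.
have [[x px]|nx] := pselect (exists x, root p x); last first.
  by exists [::] => x px; case: nx; exists x.
have [q pq] := factor_theorem p x px.
have q0 : q != 0 by apply: contraNneq p0 => q0; rewrite pq q0 mul0r.
have [|s hs] := IHn q _ q0.
  by move: pn; rewrite pq size_Mmonic ?monicXsubC // size_XsubC addn2.
exists (x :: s) => y; rewrite pq rootM root_XsubC inE => /orP[/hs->|->] //; exact: orbT.
Qed.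

(** Take a rational strictly between the two numbers and clear its denominator. *)
Lemma separating_int_affine a b : a != b -> exists c e : int,
  Num.sg (c%:~R * a + e%:~R) != Num.sg (c%:~R * b + e%:~R :> R).
Proof.
wlog ab : a b / a < b => [th|_].
  move=> nab; case: (ltgtP a b) nab => // ab _; first by apply: th; rewrite // lt_eqF.
  by have [|c [e h]] := th b a ab; [rewrite lt_eqF|exists c, e; rewrite eq_sym].
have [q aqb] := rat_in_itvoo ab.
exists (denq q), (- numq q).
have d0 : 0 < (denq q)%:~R :> R by rewrite ltr0z denq_gt0.
have qE : ratr q = (numq q)%:~R / (denq q)%:~R :> R by rewrite /ratr.
move: aqb; rewrite in_itv /= qE ltr_pdivlMr // ltr_pdivrMr // => /andP[h1 h2].
have lt0 : (denq q)%:~R * a + (- numq q)%:~R < 0 by rewrite mulrNz subr_lt0 mulrC.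
have gt0 : 0 < (denq q)%:~R * b + (- numq q)%:~R by rewrite mulrNz subr_gt0 mulrC.
by rewrite (ltr0_sg lt0) (gtr0_sg gt0) lt_eqF //; lra.
Qed.

(** * Rigid numbers and rigid vectors *)

Definition rigid_number x := exists2 L, rigid L & scalar_vec x \in L.

(* The relations forced on a normalized realization make its value a root of the same
   integer polynomial, and finitely many integer affine functions isolate a root by signs. *)
Lemma rigid_number_algebraic a : algebraic_real a -> rigid_number a.
Proof.
move=> [p [p0 pa]].
have q0 : map_poly intr p != 0 :> {poly R}.
  by rewrite map_poly_eq0_id0 // intr_eq0 lead_coef_eq0.
have [s hs] := finite_roots q0.
(* [L] is to single out [a] among the candidates [s]. Adding a list that computes [p] at [a] puts
   the value among them: [p] at [a] is 0, so its value has sign 0. *)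
suff [L aL [hroot hL]] : exists2 L, scalar_vec a \in L &
    (forall rho, normalized L rho -> val rho a \in s -> val rho a = a) /\
    (forall rho, normalized L rho -> val rho a = a -> forall r, r \in L -> fixes rho r).
  have [L1 [a1 p1 h1]] := computable_poly a p.
  exists (L ++ L1); last by rewrite mem_cat aL.
  move=> rho nrho.
  have n0 : normalized L rho by apply: normalized_sub nrho => r rL; rewrite mem_cat rL.
  have n1 : normalized L1 rho by apply: normalized_sub nrho => r rL; rewrite mem_cat rL orbT.
  have [vp f1] := h1 rho n1.
  have va : val rho a = a.
    apply: hroot => //; apply: hs; rewrite /root -vp pa -sgr_eq0 (sg_val n1) ?sgr0 //.
    by rewrite mem_cat -pa p1 orbT.
  by move=> r; rewrite mem_cat => /orP[]; [apply: hL|apply: f1].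
elim: s {hs} => [|b s [L aL [h1 h2]]].
  have [L [aL _ h]] := computable_id a.
  by exists L => //; split=> // rho nrho va; have [_] := h rho nrho; apply.
have [->|ab] := eqVneq b a.
  exists L => //; split=> // rho nrho; rewrite inE => /orP[/eqP//|]; exact: h1.
(* The value of [c a + e] keeps its sign, which excludes [b] as a value of [a]. *)
have [c [e ce]] := separating_int_affine ab.
have [L1 [a1 p1 g1]] := computable_poly a (c%:P * 'X + e%:P).
exists (L ++ L1); first by rewrite mem_cat aL.
split=> rho nrho; have n0 : normalized L rho by apply: normalized_sub nrho => r rL; rewrite mem_cat rL.
  have n1 : normalized L1 rho by apply: normalized_sub nrho => r rL; rewrite mem_cat rL orbT.
  have [vp _] := g1 rho n1; rewrite inE => /orP[/eqP vb|]; last exact: h1.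
  have := sg_val n1 (x := (map_poly intr (c%:P * 'X + e%:P)).[a]).
  rewrite vp vb mem_cat p1 orbT => /(_ isT).
  rewrite rmorphD rmorphM /= map_polyX !map_polyC /= !hornerMXaddC !hornerC => /eqP.
  by rewrite (negPf ce).
have n1 : normalized L1 rho by apply: normalized_sub nrho => r rL; rewrite mem_cat rL orbT.
move=> va r; rewrite mem_cat => /orP[]; first exact: h2.
by have [_] := g1 rho n1; apply.
Qed.

Lemma rigid_numberD x y : rigid_number x -> rigid_number y -> rigid_number (x + y).
Proof.
move=> [L1 r1 x1] [L2 r2 y2]; pose A := add_list x y.
exists ((L1 ++ L2) ++ A); last by rewrite mem_cat !inE eqxx !orbT.
move=> rho nrho r; rewrite mem_cat => /orP[rL|].
  apply: (rigid_cat r1 r2) => //; apply: normalized_sub nrho => v vL; by rewrite mem_cat vL.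
have sA : {subset A <= (L1 ++ L2) ++ A} by move=> v vL; rewrite !mem_cat vL ?orbT.
apply: (fixes_add_list nrho) => //; apply: val_fixed.
  by apply: r1 => //; apply: normalized_sub nrho => v vL; rewrite !mem_cat vL.
by apply: r2 => //; apply: normalized_sub nrho => v vL; rewrite !mem_cat vL ?orbT.
Qed.

Lemma rigid_numberN x : rigid_number x -> rigid_number (- x).
Proof.
move=> [L1 r1 x1]; pose A := add_list x (- x).
exists (L1 ++ A); last by rewrite mem_cat !inE eqxx !orbT.
move=> rho nrho; have n1 : normalized L1 rho.
  by apply: normalized_sub nrho => v vL; rewrite mem_cat vL.
have sA : {subset A <= L1 ++ A} by move=> v vL; rewrite !mem_cat vL ?orbT.
have vx : val rho x = x by apply: val_fixed; apply: r1.
move=> r; rewrite mem_cat => /orP[|]; first exact: r1.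
by apply: (fixes_add_list nrho) => //; rewrite (val_opp nrho sA) vx.
Qed.

Lemma algebraic_int (c : int) : algebraic_real (c%:~R : R).
Proof.
exists ('X - c%:P); rewrite polyXsubC_eq0; split=> //.
by rewrite rmorphB /= map_polyX map_polyC /= hornerXsubC subrr.
Qed.

Lemma rigid_numberMz x (c : int) : rigid_number x -> rigid_number (x *~ c).
Proof.
move=> hx; have nat_case n : rigid_number (x *+ n).
  elim: n => [|n IHn]; first exact: rigid_number_algebraic (algebraic_int 0).
  by rewrite mulrS; apply: rigid_numberD.
by case: c => n; rewrite ?NegzE ?mulrNz; [|apply: rigid_numberN]; exact: nat_case.
Qed.

Lemma rigid_number_sum (I : Type) (s : seq I) (F : I -> R) :
  (forall i, rigid_number (F i)) -> rigid_number (\sum_(i <- s) F i).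
Proof.
move=> hF; apply: big_rec => [|i x _ hx]; last exact: rigid_numberD.
exact: rigid_number_algebraic (algebraic_int 0).
Qed.

Definition rigid_vec r := exists2 L, rigid L & r \in L.

Lemma rigid_vec_ratio r (a : 'I_k) : (a < 2)%N -> r 0 a = 1 ->
  (forall b : 'I_k, (2 <= b)%N -> rigid_number (r 0 b)) ->
  (forall b : 'I_k, (b < 2)%N -> r 0 b = 1 \/ r 0 b = 0) -> rigid_vec r.
Proof.
move=> a2 ra hr h01.
have /choice[Ls hLs] (b : 'I_k) : exists L, rigid L /\
    ((2 <= b)%N -> scalar_vec (r 0 b) \in L).
  case: (ltnP b 2) => b2; first by exists [::]; split=> // rho _ v.
  by have [L rL bL] := hr b b2; exists L.
pose A := flatten (codom Ls).
have sub b : {subset Ls b <= A ++ [:: r]}.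
  by move=> v vL; rewrite mem_cat; apply/orP; left; apply/flattenP; exists (Ls b); rewrite ?codom_f.
have rA : r \in A ++ [:: r] by rewrite mem_cat mem_head orbT.
exists (A ++ [:: r]) => // rho nrho v; rewrite mem_cat inE => /orP[/flattenP[_ /codomP[b ->] vL]|/eqP->].
  by have [rL _] := hLs b; apply: rL => //; apply: normalized_sub nrho.
have rF : r \in frame ++ (A ++ [:: r]) by rewrite mem_cat rA orbT.
apply: (fixes_coord nrho (a := a)) => // b; case: (ltnP b 2) => b2.
  case: (h01 b b2) => rb; rewrite rb ?mul1r ?mul0r; last exact: (coord0 nrho).
  by apply: (eq_coord nrho) => //; rewrite ra rb.
have [rL bL] := hLs b.
rewrite (ratio_val nrho (x := r 0 b) (a := a) _ rF) ?a2 ?ra ?mulr1 //.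
  by rewrite val_fixed //; apply: rL (bL b2); apply: normalized_sub nrho.
by rewrite mem_cat (sub b) ?orbT // bL.
Qed.

(** For [b >= 3] both coordinates are numerators, so [ratio_val] says nothing about their ratio. The
    vector [v] shows the ratio [y] of coordinates 2 and [b] next to a denominator, and the form
    [x_2 - y x_b] carries it over to [w]. *)
Lemma rigid_vec_pair (b : 'I_k) y : b != i2 -> rigid_number y ->
  rigid_vec (delta_mx 0 b + y *: delta_mx 0 i2).
Proof.
move=> b2 hy; set w : vec := _ + _.
have wE c : w 0 c = (c == b)%:R + y * (c == i2)%:R by rewrite !mxE.
pose v : vec := \row_c (if (c == i0) || (c == b) then 1 else if c == i2 then y else 0).
have [L rL vL] : rigid_vec v.
  apply: (@rigid_vec_ratio v i0) => // [|c _|c c2]; rewrite mxE ?eqxx //.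
    case: ifP => _; first exact: rigid_number_algebraic (algebraic_int 1).
    by case: ifP => // _; exact: rigid_number_algebraic (algebraic_int 0).
  case: ifP => _; first by left.
  by case: eqP => [ci|]; [rewrite ci in c2|right].
exists (w :: L); last exact: mem_head.
move=> rho nrho; have nL : normalized L rho by apply: normalized_sub nrho => r rL'; rewrite inE rL' orbT.
have fv : fixes rho v by apply: rL.
have wF : w \in frame ++ w :: L by rewrite mem_cat mem_head orbT.
have vF : v \in frame ++ w :: L by rewrite mem_cat (in_cons w) vL !orbT.
move=> r; rewrite inE => /orP[/eqP->|]; last exact: rL.
have wb : w 0 b = 1 by rewrite wE eqxx (negPf b2) mulr0 addr0.
apply: (fixes_coord nrho (a := b)) => // c; rewrite wE.
have [->|cb] := eqVneq c b; first by rewrite (negPf b2) mulr0 addr0 mul1r.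
have [->|c2] := eqVneq c i2; last first.
  by rewrite mulr0 addr0 mul0r (coord0 nrho) // wE (negPf cb) (negPf c2) mulr0 addr0.
rewrite add0r mulr1; have [x' h] := ratio_transfer nrho y b2.
have v2 : v 0 i2 = y by rewrite mxE /= eq_sym (negPf b2).
have vb : v 0 b = 1 by rewrite mxE eqxx orbT.
have [c' c0 rv] := fv.
have e2 : rho v 0 i2 = c' * y by rewrite rv mxE v2.
have eb : rho v 0 b = c' by rewrite rv mxE vb mulr1.
have /eqP := h _ vF; rewrite v2 vb mulr1 subrr sgr0 sgr_eq0 e2 eb.
rewrite mulrC -mulrBl mulf_eq0 (gt_eqF c0) orbF subr_eq0 => /eqP yx.
have /eqP := h _ wF; rewrite wb wE [i2 == b]eq_sym (negPf b2) eqxx add0r !mulr1 subrr sgr0 sgr_eq0 subr_eq0.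
by rewrite -yx => /eqP.
Qed.

Lemma rigid_vecs (s : seq vec) : (forall r, r \in s -> rigid_vec r) ->
  exists2 L, rigid L & {subset s <= L}.
Proof.
elim: s => [|r s IHs] h; first by exists [::].
have [|L rL sL] := IHs; first by move=> v vs; apply: h; rewrite inE vs orbT.
have [L1 r1 rL1] := h r (mem_head _ _).
exists (L1 ++ L); first exact: rigid_cat.
move=> v; rewrite inE mem_cat => /orP[/eqP->|/sL->]; first by rewrite rL1.
exact: orbT.
Qed.

End RigidLists.

Local Open Scope classical_set_scope.

(** * Convex hulls and their faces *)
Section Hulls.
Variables (R : realType) (d : nat).
Implicit Types (I J : finType) (a x v : 'rV[R]_d) (s : seq 'rV[R]_d).

Definition hull I (V : I -> 'rV[R]_d) : set 'rV[R]_d :=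
  [set x | exists l : I -> R, (forall i, 0 <= l i) /\ \sum_i l i = 1 /\ x = \sum_i l i *: V i].

Lemma convE s : conv s = hull (fun i : 'I_(size s) => s`_i).
Proof. by []. Qed.

Lemma mem_hull I (V : I -> 'rV[R]_d) i : hull V (V i).
Proof.
exists (fun j => (j == i)%:R); split=> [j|]; first exact: ler0n.
split; first by rewrite (bigD1 i) //= eqxx big1 ?addr0 // => j /negPf->.
by rewrite (bigD1 i) //= eqxx scale1r big1 ?addr0 // => j /negPf->; rewrite scale0r.
Qed.

(** Asking only for the points of positive weight lets a face be described by the generators lying
    on it. *)
Lemma hull_comb I J (V : I -> 'rV[R]_d) (W : J -> 'rV[R]_d) l :
  (forall i, 0 <= l i) -> \sum_i l i = 1 -> (forall i, 0 < l i -> hull W (V i)) ->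
  hull W (\sum_i l i *: V i).
Proof.
move=> l0 l1 h.
have /choice[c hc] i : exists c : J -> R, [/\ forall j, 0 <= l i * c j,
    l i * \sum_j c j = l i & l i *: V i = l i *: \sum_j c j *: W j].
  have [->|li] := eqVneq (l i) 0.
    by exists (fun=> 0); split=> [j||]; rewrite ?mul0r ?scale0r.
  have [|c [c0 [c1 cV]]] := h i; first by rewrite lt_def li l0.
  by exists c; split=> [j||]; rewrite ?c1 ?mulr1 -?cV // mulr_ge0.
exists (fun j => \sum_i l i * c i j); split=> [j|].
  by apply: sumr_ge0 => i _; case: (hc i).
split.
  rewrite exchange_big -l1 /=; apply: eq_bigr => i _.
  by rewrite -mulr_sumr; case: (hc i).
under [RHS]eq_bigr do rewrite scaler_suml.
rewrite exchange_big /=; apply: eq_bigr => i _; have [_ _ ->] := hc i.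
by rewrite scaler_sumr; apply: eq_bigr => j _; rewrite scalerA.
Qed.

Lemma hull_sub I J (V : I -> 'rV[R]_d) (W : J -> 'rV[R]_d) :
  (forall i, hull W (V i)) -> hull V `<=` hull W.
Proof. by move=> h x [l [l0 [l1 ->]]]; apply: hull_comb. Qed.

Lemma hull_eq I J (V : I -> 'rV[R]_d) (W : J -> 'rV[R]_d) :
  (forall i, hull W (V i)) -> (forall j, hull V (W j)) -> hull V = hull W.
Proof. by move=> h1 h2; apply/seteqP; split; apply: hull_sub. Qed.

Lemma mem_conv s v : v \in s -> conv s v.
Proof.
move=> vs; have hv : (index v s < size s)%N by rewrite index_mem.
by rewrite convE; have := mem_hull (fun i : 'I_(size s) => s`_i) (Ordinal hv); rewrite /= nth_index.
Qed.

Lemma polytope_hull I (V : I -> 'rV[R]_d) : polytope (hull V).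
Proof.
exists (codom V); rewrite convE; apply: hull_eq => [i|j].
  by rewrite -convE; apply: mem_conv; apply: codom_f.
by have /codomP[i ->] := mem_nth 0 (ltn_ord j); apply: mem_hull.
Qed.

Lemma dotv_hull_le I (V : I -> 'rV[R]_d) a b (l : I -> R) :
  (forall i, dotv a (V i) <= b) -> (forall i, 0 <= l i) -> \sum_i l i = 1 ->
  dotv a (\sum_i l i *: V i) <= b.
Proof.
move=> ab l0 l1; rewrite dotv_sumr -[b]mul1r -l1 mulr_suml.
by apply: ler_sum => i _; rewrite dotvZr ler_wpM2l.
Qed.

(** The slack of a combination is the weighted sum of the nonnegative slacks of its points. *)
Lemma dotv_hull_eq I (V : I -> 'rV[R]_d) a b (l : I -> R) :
  (forall i, dotv a (V i) <= b) -> (forall i, 0 <= l i) -> \sum_i l i = 1 ->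
  dotv a (\sum_i l i *: V i) = b <-> forall i, 0 < l i -> dotv a (V i) = b.
Proof.
move=> ab l0 l1.
have eqb : b - dotv a (\sum_i l i *: V i) = \sum_i l i * (b - dotv a (V i)).
  rewrite dotv_sumr -{1}[b]mul1r -l1 mulr_suml -sumrB.
  by apply: eq_bigr => i _; rewrite dotvZr mulrBr.
split=> [eb i li|h].
  move/eqP: eqb; rewrite eb subrr eq_sym psumr_eq0 => [/allP h|j _]; last first.
    by rewrite mulr_ge0 // subr_ge0.
  have := h i (mem_index_enum i); rewrite /= mulf_eq0 (gt_eqF li) subr_eq0 => /eqP->//.
apply/esym/eqP; rewrite -subr_eq0 eqb big1 // => i _.
have [->|li] := eqVneq (l i) 0; first by rewrite mul0r.
by rewrite h ?subrr ?mulr0 // lt_def li l0.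
Qed.

Lemma hull_coef_gt0 I (l : I -> R) : (forall i, 0 <= l i) -> \sum_i l i = 1 -> exists i, 0 < l i.
Proof.
move=> l0 l1; apply: contrapT => h; have : \sum_i l i = 0.
  apply: big1 => i _; apply/eqP; rewrite eq_le l0 andbT leNgt; apply/negP => li; apply: h.
  by exists i.
by rewrite l1 => /eqP; rewrite oner_eq0.
Qed.

Lemma face_hullP I (V : I -> 'rV[R]_d) F : face (hull V) F ->
  forall l : I -> R, (forall i, 0 <= l i) -> \sum_i l i = 1 ->
  F (\sum_i l i *: V i) <-> forall i, 0 < l i -> F (V i).
Proof.
move=> [a [b [ab ->]]] l l0 l1.
have aV i : dotv a (V i) <= b by apply: ab; exact: mem_hull.
have [h1 h2] := dotv_hull_eq aV l0 l1; split=> [[_ /h1 h] i /h h'|h].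
  by split=> //; exact: mem_hull.
split; last by apply: h2 => i /h[].
by exists l.
Qed.

Lemma face_hull_mem I (V : I -> 'rV[R]_d) F x : face (hull V) F -> F x -> exists i, F (V i).
Proof.
move=> fF Fx; have [l [l0 [l1 xE]]] : hull V x by case: fF Fx => a [b [_ ->]] [].
have [i li] := hull_coef_gt0 l0 l1; exists i.
by move: i li; apply/(face_hullP fF l0 l1); rewrite -xE.
Qed.

Lemma exposed_vertex I (V : I -> 'rV[R]_d) i a :
  (forall j, dotv a (V j) <= dotv a (V i)) ->
  (forall j, dotv a (V j) = dotv a (V i) -> V j = V i) -> vertex (hull V) (V i).
Proof.
move=> aV eqV; exists a, (dotv a (V i)); split=> [x [l [l0 [l1 ->]]]|].
  exact: dotv_hull_le.
apply/seteqP; split=> [_ ->|_ [[l [l0 [l1 ->]]] h]] /=; first by split=> //; exact: mem_hull.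
rewrite (eq_bigr (fun j => l j *: V i)) => [|j _]; first by rewrite -scaler_suml l1 scale1r.
have [->|lj] := eqVneq (l j) 0; first by rewrite !scale0r.
rewrite (eqV j) //; move: j lj => j lj; apply: (dotv_hull_eq aV l0 l1).1 => //.
by rewrite lt_def lj l0.
Qed.

Lemma face0 (P : set 'rV[R]_d) : face P set0.
Proof.
exists 0, 1; split=> [x _|]; first by rewrite dotv0l.
by apply/seteqP; split=> // x [_] /=; rewrite dotv0l => /eqP; rewrite eq_sym oner_eq0.
Qed.

End Hulls.

(** * Separation and the vertices of a polytope *)

Section Farkas.
Variable R : realType.

(* Induction on the number of constraints: if the last constraint [b] matters, some [x0]
   violates only it, and projecting along [x0] onto the kernel of [b] removes [b]. *)
Lemma farkas d (A : seq 'rV[R]_d) (c : 'rV[R]_d) :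
  (forall x, (forall a, a \in A -> dotv a x <= 0) -> dotv c x <= 0) ->
  exists l : nat -> R, (forall i, 0 <= l i) /\ c = \sum_(i < size A) l i *: A`_i.
Proof.
have [n] := ubnP (size A); elim: n A c => // n IHn [|b A] c sA h.
  exists (fun=> 0); split=> //; rewrite big_ord0; apply/eqP; rewrite -dotvv_eq0 eq_le dotvv_ge0.
  by rewrite h.
have [hA|] := pselect (forall x, (forall a, a \in A -> dotv a x <= 0) -> dotv c x <= 0).
  have [l [l0 ->]] := IHn A c sA hA.
  exists (fun i => if i is j.+1 then l j else 0); split=> [[|i]//|].
  by rewrite big_ord_recl scale0r add0r.
move=> /existsNP[x0 /not_implyP[Ax0 /negP]]; rewrite -ltNge => cx0.
have bx0 : 0 < dotv b x0.
  rewrite ltNge; apply/negP => bx0; move: cx0; rewrite ltNge h // => a.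
  by rewrite inE => /predU1P[->//|/Ax0].
pose pr a := a - (dotv a x0 / dotv b x0) *: b.
have prE a x : dotv (pr a) x = dotv a (x - (dotv b x / dotv b x0) *: x0).
  rewrite /pr dotvBl dotvBr dotvZl dotvZr; congr (_ - _).
  by rewrite mulrC mulrA [RHS]mulrAC.
have [||l [l0 cE]] := IHn (map pr A) (pr c); first by rewrite size_map.
  move=> x hx; rewrite prE; apply: h => a; rewrite inE => /predU1P[->|aA].
    by rewrite dotvBr dotvZr divfK ?subrr // gt_eqF.
  by rewrite -prE; apply: hx; rewrite map_f.
pose m := (dotv c x0 - \sum_(i < size A) l i * dotv A`_i x0) / dotv b x0.
exists (fun i => if i is j.+1 then l j else m); split=> [[|i]//|].
  rewrite divr_ge0 ?(ltW bx0) // subr_ge0 (le_trans _ (ltW cx0)) // sumr_le0 // => i _.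
  by rewrite mulr_ge0_le0 // Ax0 // mem_nth.
rewrite big_ord_recl /= addrC; apply/eqP; rewrite -subr_eq.
have -> : c - m *: b = pr c + (dotv c x0 / dotv b x0 - m) *: b.
  by rewrite /pr scalerBl addrA subrK.
rewrite cE size_map /m mulrBl subKr.
apply/eqP; rewrite mulr_suml scaler_suml -big_split; apply: eq_bigr => i _ /=.
by rewrite (nth_map 0) // /pr scalerBr scalerA mulrA subrK.
Qed.

(** Farkas for the lifted points [(u, 1)]: if [(v, 1)] lies in their cone, the last coordinate makes
    the weights sum to 1; otherwise a form separates, and its constant term cancels. *)
Lemma conv_separation d (s : seq 'rV[R]_d) v :
  ~ conv s v -> exists a, forall u, u \in s -> dotv a u < dotv a v.
Proof.
move=> nv; pose h (x : 'rV[R]_d) : 'rV[R]_(d + 1) := row_mx x (const_mx 1).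
have xE (y : 'rV[R]_d) x : dotv (h y) x = dotv (lsubmx x) y + x 0 (rshift d 0).
  rewrite -{1}[x]hsubmxK /h dotv_row_mx dotvC; congr (_ + _).
  by rewrite /dotv big_ord1 !mxE mul1r.
have [hA|] := pselect (forall x, (forall a, a \in map h s -> dotv a x <= 0) -> dotv (h v) x <= 0).
  have [l [l0]] := farkas hA; rewrite size_map => hv; case: nv.
  exists (fun i => l i); split=> //.
  split.
    have := congr1 (fun w => rsubmx w 0 0) hv; rewrite linear_sum summxE /= row_mxKr mxE => e.
    by rewrite [RHS]e; apply: eq_bigr => i _; rewrite linearZ /= (nth_map 0) // row_mxKr !mxE mulr1.
  have := congr1 lsubmx hv; rewrite linear_sum /= row_mxKl => ->.
  by apply: eq_bigr => i _; rewrite linearZ /= (nth_map 0) // row_mxKl.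
move=> /existsNP[x /not_implyP[Ax /negP]]; rewrite -ltNge => vx.
exists (lsubmx x) => u us.
have := Ax (h u); rewrite map_f // => /(_ isT).
by move: vx; rewrite !xE => h1 h2; rewrite -(ltrD2r (x 0 (rshift d 0))) (le_lt_trans h2).
Qed.

(** Discard generators lying in the hull of the others, which also removes repetitions; each
    remaining one is strictly separated from the rest and hence exposed. *)
Lemma polytope_vertices d (P : set 'rV[R]_d) : polytope P ->
  exists s : seq 'rV[R]_d, P = conv s /\ forall v, v \in s -> vertex P v.
Proof.
move=> [s ->]; have [n] := ubnP (size s); elim: n s => // n IHn s sn.
have [[v [vs hv]]|h] := pselect (exists v, v \in s /\ conv (rem v s) v).
  suff -> : conv s = conv (rem v s).
    by apply: IHn; rewrite size_rem //; move: sn; case: (s) vs.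
  rewrite !convE; apply: hull_eq => i; rewrite -convE.
    have := mem_nth 0 (ltn_ord i); set u := s`_i => us.
    have [->//|uv] := eqVneq u v; apply: mem_conv.
    by move: us; rewrite (perm_mem (perm_to_rem vs)) inE (negPf uv).
  by apply: mem_conv; apply: mem_rem (mem_nth 0 (ltn_ord i)).
exists s; split=> // v vs.
have [|a av] := @conv_separation _ (rem v s) v; first by move=> hv; apply: h; exists v.
have hav u : u \in s -> u = v \/ dotv a u < dotv a v.
  by rewrite (perm_mem (perm_to_rem vs)) inE => /predU1P[->|/av]; [left|right].
have hv : (index v s < size s)%N by rewrite index_mem.
have vE : v = s`_(Ordinal hv) by rewrite /= nth_index.
rewrite [X in vertex _ X]vE convE; apply: (@exposed_vertex _ _ _ (fun i : 'I_(size s) => s`_i) _ a) => j;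
  rewrite -vE; have [->//|lt] := hav _ (mem_nth 0 (ltn_ord j)); first exact: ltW.
by move=> e; rewrite e ltxx in lt.
Qed.

Definition homog d (x : 'rV[R]_d) : 'rV[R]_(d + 1) := row_mx x (1 : 'rV[R]_1).

Lemma dotv_homog d (a : 'rV[R]_d) (b : R) x : dotv (row_mx a b%:M) (homog x) = dotv a x + b.
Proof. by rewrite dotv_row_mx; congr (_ + _); rewrite /dotv big_ord1 !mxE mulr1. Qed.

Lemma homog_dotv d (L : 'rV[R]_(d + 1)) x : dotv L (homog x) = dotv (lsubmx L) x + rsubmx L 0 0.
Proof. by rewrite -dotv_homog -{1}[L]hsubmxK; congr (dotv (row_mx _ _) _); rewrite [LHS]mx11_scalar. Qed.

Lemma homog_sum d (I : finType) (V : I -> 'rV[R]_d) l :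
  \sum_i l i *: homog (V i) = row_mx (\sum_i l i *: V i) (\sum_i l i)%:M.
Proof.
rewrite -[LHS]hsubmxK !linear_sum; congr row_mx.
  by apply: eq_bigr => i _; rewrite linearZ /= row_mxKl.
apply/rowP => j; rewrite !ord1 mxE summxE /=; apply: eq_bigr => i _.
by rewrite linearZ /= row_mxKr !mxE mulr1.
Qed.

Lemma homog_conv d (I : finType) (V : I -> 'rV[R]_d) l : \sum_i l i = 1 ->
  \sum_i l i *: homog (V i) = homog (\sum_i l i *: V i).
Proof. by move=> l1; rewrite homog_sum l1. Qed.

End Farkas.

(** * Combinatorial isomorphisms *)
Section CombinatorialIsomorphism.
Variables (R : realType) (d : nat) (P Q : set 'rV[R]_d) (phi : set 'rV[R]_d -> set 'rV[R]_d).
Hypothesis iso : comb_iso P Q phi.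

Lemma iso_face F : face P F -> face Q (phi F).
Proof. by case: iso => h _; apply: h. Qed.

Lemma iso_le F1 F2 : face P F1 -> face P F2 -> (F1 `<=` F2 <-> phi F1 `<=` phi F2).
Proof. by case: iso => _ [_ h]; apply: h. Qed.

Lemma iso_set0 : phi set0 = set0.
Proof.
have [_ [/(_ _ (face0 Q))[F [fF F0]] _]] := iso.
apply/seteqP; split=> //; rewrite -[X in _ `<=` X]F0.
by apply: (iso_le (face0 P) fF).1.
Qed.

Lemma iso_nonempty F : face P F -> (exists x, F x) <-> (exists x, phi F x).
Proof.
move=> fF; split=> [[x Fx]|[x Fx]]; apply: contrapT => h.
  suff : F `<=` set0 by move=> /(_ x Fx).
  by apply: (iso_le fF (face0 P)).2 => y Fy; case: h; exists y.
suff : phi F `<=` set0 by move=> /(_ x Fx).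
rewrite -iso_set0; apply: (iso_le fF (face0 P)).1 => y Fy.
by case: h; exists y.
Qed.

End CombinatorialIsomorphism.

(** * From the transfer of valid forms to projective uniqueness *)

Section ProjectiveUniqueness.
Variables (R : realType) (d : nat) (I : finType) (V : I -> 'rV[R]_d).

(** Atoms correspond: the image of a vertex is nonempty, so it contains a vertex of [Q], and the
    preimage of that vertex is a nonempty face inside a singleton. *)
Lemma iso_vertices Q phi : (forall i, vertex (hull V) (V i)) ->
  polytope Q -> comb_iso (hull V) Q phi ->
  exists W : I -> 'rV[R]_d, (forall i, phi [set V i] = [set W i]) /\ Q = hull W.
Proof.
move=> vV pQ iso; have [s [QE sv]] := polytope_vertices pQ.
have QI : Q = hull (fun i : 'I_(size s) => s`_i) by rewrite QE.
have /choice[W hW] i : exists w, phi [set V i] = [set w].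
  have fV := vV i; have [w0 w0i] := (iso_nonempty iso fV).1 (ex_intro _ _ erefl).
  have fW := iso_face iso fV; rewrite QI in fW.
  have [j wj] := face_hull_mem fW w0i.
  have fj : face Q [set s`_j] by apply: sv; exact: mem_nth.
  have [_ [/(_ _ fj)[F [fF phiF]] _]] := iso.
  have FV : F `<=` [set V i] by apply: (iso_le iso fF fV).2; rewrite phiF => _ ->.
  exists s`_j; rewrite -phiF; congr phi; apply/seteqP; split=> // _ ->.
  have phix : exists x, phi F x by exists s`_j; rewrite phiF.
  have [x Fx] := (iso_nonempty iso fF).2 phix.
  by rewrite -(FV x Fx).
exists W; split=> //.
rewrite QI; apply: hull_eq => j.
  have fj : face Q [set s`_j] by apply: sv; exact: mem_nth.
  have [_ [/(_ _ fj)[F [fF phiF]] _]] := iso.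
  have phix : exists x, phi F x by exists s`_j; rewrite phiF.
  have [x Fx] := (iso_nonempty iso fF).2 phix.
  have [i Fi] := face_hull_mem fF Fx.
  have := (iso_le iso (vV i) fF).1; rewrite phiF hW => /(_ _ (W i)) /= <- //; last by move=> _ ->.
  exact: mem_hull.
rewrite -QI; have [a [b [_ Wj]]] := iso_face iso (vV j).
by have : [set W j] (W j) by []; rewrite -hW Wj => -[].
Qed.

(* [M] maps each vertex ray [(V i, 1)] onto the ray [(W i, 1)]; the positivity of [mu]
   makes the denominator positive on the whole polytope. *)
Lemma proj_unique_hull : (forall i, vertex (hull V) (V i)) ->
  (forall W : I -> 'rV[R]_d,
    (forall L, (forall i, 0 <= dotv L (homog (V i))) -> exists L', forall i,
      0 <= dotv L' (homog (W i)) /\ (dotv L' (homog (W i)) = 0 <-> dotv L (homog (V i)) = 0)) ->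
    exists2 M : 'M[R]_(d + 1), M \in unitmx & exists mu : I -> R,
      forall i, 0 < mu i /\ homog (W i) = mu i *: (homog (V i) *m M)) ->
  proj_unique (hull V).
Proof.
move=> vV rig Q phi pQ iso; have [W [phiV QE]] := iso_vertices vV pQ iso.
have phiF F i : face (hull V) F -> phi F (W i) <-> F (V i).
  move=> fF; have h := iso_le iso (vV i) fF; rewrite phiV in h.
  by split=> [Wi|Vi]; [apply: h.2 => // _ ->|apply: h.1 => // _ ->].
(* The zeros of a nonnegative form cut out a face, and an inequality defining the image of that face
   under [phi] is the required counterpart. *)
have [L aL|M Mu [mu hmu]] := rig W.
  pose a := - lsubmx L; pose b := rsubmx L 0 0.
  have Lab x : dotv L (homog x) = b - dotv a x by rewrite homog_dotv dotvNl opprK addrC.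
  have fF : face (hull V) (hull V `&` [set x | dotv a x = b]).
    exists a, b; split=> // x [l [l0 [l1 ->]]]; apply: dotv_hull_le => // i.
    by rewrite -subr_ge0 -Lab.
  have [a' [b' [ab' phiE]]] := iso_face iso fF.
  exists (row_mx (- a') b'%:M) => i; rewrite dotv_homog dotvNl addrC subr_ge0.
  have QW : Q (W i) by rewrite QE; exact: mem_hull.
  split; first exact: ab'.
  have := phiF _ i fF; rewrite phiE Lab.
  split=> [/eqP|/eqP]; rewrite subr_eq0 => /eqP e; apply/eqP; rewrite subr_eq0; apply/eqP/esym.
    by have [] := H.1 (conj QW (esym e)).
  by have [] := H.2 (conj (mem_hull V i) (esym e)).
have mu0 i : 0 < mu i by case: (hmu i).
have key (l : I -> R) : (forall i, 0 <= l i) -> \sum_i l i = 1 ->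
    exists2 m : I -> R, (forall i, 0 <= m i /\ (0 < m i <-> 0 < l i)) /\ \sum_i m i = 1 &
    proj_denom M (\sum_i l i *: V i) != 0 /\
    proj_map M (\sum_i l i *: V i) = \sum_i m i *: W i.
  (* [M] sends [(V i, 1)] to [(W i, 1)] divided by [mu i], so the weights become [l i / mu i] and
     the denominator is their sum. *)
  move=> l0 l1; pose n i := l i / mu i; pose S := \sum_i n i.
  have n0 i : 0 <= n i by apply: divr_ge0 => //; exact: ltW.
  have S0 : 0 < S.
    have [i li] := hull_coef_gt0 l0 l1; rewrite /S (bigD1 i) //= ltr_pwDl ?sumr_ge0 //.
    by rewrite divr_gt0.
  have hE : proj_hom M (\sum_i l i *: V i) = row_mx (\sum_i n i *: W i) S%:M.
    rewrite -homog_sum /proj_hom -/(homog _) -homog_conv // mulmx_suml; apply: eq_bigr => i _.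
    by have [_ ->] := hmu i; rewrite -scalemxAl scalerA divfK ?gt_eqF.
  have dE : proj_denom M (\sum_i l i *: V i) = S by rewrite /proj_denom hE row_mxKr mxE.
  exists (fun i => n i / S); last first.
    rewrite dE gt_eqF //; split=> //; rewrite /proj_map dE hE row_mxKl scaler_sumr.
    by apply: eq_bigr => i _; rewrite scalerA mulrC.
  split=> [i|]; last by rewrite -mulr_suml divff // gt_eqF.
  by rewrite divr_ge0 ?(ltW S0) // !pmulr_lgt0 ?invr_gt0.
have imF F : face (hull V) F -> proj_map M @` F = phi F.
  move=> fF; have fW := iso_face iso fF; rewrite QE in fW.
  apply/seteqP; split=> [_ [x Fx <-]|y Fy].
    have [l [l0 [l1 xE]]] : hull V x by case: fF Fx => a [b [_ ->]] [].
    have [m [m0 m1] [_ mE]] := key l l0 l1; rewrite xE mE.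
    rewrite xE in Fx; have Fl := (face_hullP fF l0 l1).1 Fx.
    apply: (face_hullP fW _ m1).2 => [i|i /(m0 i).2.1 li]; first by case: (m0 i).
    by apply/phiF => //; exact: Fl.
  have [m [m0 [m1 yE]]] : hull W y by case: fW Fy => a [b [_ ->]] [].
  rewrite yE in Fy; have Fm := (face_hullP fW m0 m1).1 Fy.
  (* For a preimage of [y], the change of weights is inverted: multiply by [mu] and normalize. *)
  pose S := \sum_i m i * mu i.
  have S0 : 0 < S.
    have [i mi] := hull_coef_gt0 m0 m1; rewrite /S (bigD1 i) //= ltr_pwDl ?mulr_gt0 ?sumr_ge0 //.
    by move=> j _; rewrite mulr_ge0 // ltW.
  pose l i := m i * mu i / S.
  have l0 i : 0 <= l i by rewrite divr_ge0 ?mulr_ge0 ?(ltW (mu0 i)) ?(ltW S0).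
  have l1 : \sum_i l i = 1 by rewrite -mulr_suml divff // gt_eqF.
  exists (\sum_i l i *: V i).
    apply: (face_hullP fF l0 l1).2 => i li; apply/phiF => //; apply: Fm.
    by move: li; rewrite /l -mulrA pmulr_lgt0 // divr_gt0.
  have dE : proj_hom M (\sum_i l i *: V i) = S^-1 *: row_mx y (1 : 'rV_1).
    rewrite /proj_hom -/(homog _) -homog_conv // mulmx_suml -/(homog y) yE -(homog_conv _ m1) scaler_sumr.
    apply: eq_bigr => i _; have [_ ->] := hmu i.
    by rewrite -scalemxAl !scalerA /l mulrC.
  by rewrite /proj_map /proj_denom dE scale_row_mx row_mxKr row_mxKl !mxE mulr1 invrK scalerA divff ?scale1r // gt_eqF.
exists M; split=> //; split.
  by move=> x [l [l0 [l1 ->]]]; have [m _ []] := key l l0 l1.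
have fP : face (hull V) (hull V).
  exists 0, 0; split=> [x _|]; first by rewrite dotv0l.
  by apply/seteqP; split=> [x|x []] //; split=> //=; rewrite dotv0l.
have fQ : face Q Q.
  exists 0, 0; split=> [x _|]; first by rewrite dotv0l.
  by apply/seteqP; split=> [x|x []] //; split=> //=; rewrite dotv0l.
split=> //; rewrite imF //; apply/seteqP; split.
  by have [a [b [_ ->]]] := iso_face iso fP; move=> x [].
have [_ [/(_ _ fQ)[F [fF phiQ]] _]] := iso.
rewrite -{1}phiQ; apply: (iso_le iso fF fP).1.
by case: fF => a [b [_ ->]] x [].
Qed.

End ProjectiveUniqueness.

(** * Lawrence polytopes *)
Section Lawrence.
Variables (R : realType) (k n N : nat).
Variables (p : 'I_n -> 'rV[R]_k) (r : 'I_N -> 'rV[R]_k).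

Definition lawrence_index := option ('I_n + 'I_N * bool).

(* Apex [0], base points [p i], and each direction [r j] lifted to the pair [(r j, e_j)],
   [(- r j, e_j)]. *)
Definition lawrence (i : lawrence_index) : 'rV[R]_(k + N) :=
  match i with
  | None => 0
  | Some (inl i) => row_mx (p i) 0
  | Some (inr (j, b)) => row_mx ((-1) ^+ b *: r j) (delta_mx 0 j)
  end.

(* In the coordinates [(x, y, h)] with [h = 1 - sum y] this is [l x + c y + t h]. *)
Definition lawrence_form (l : 'rV[R]_k) (c : 'I_N -> R) (t : R) : 'rV[R]_(k + N + 1) :=
  row_mx (row_mx l (\row_j (c j - t))) t%:M.

Definition lawrence_value (l : 'rV[R]_k) (c : 'I_N -> R) (t : R) (i : lawrence_index) : R :=
  match i with
  | None => t
  | Some (inl i) => dotv l (p i) + t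
  | Some (inr (j, b)) => (-1) ^+ b * dotv l (r j) + c j
  end.

Lemma lawrence_formE l c t i :
  dotv (lawrence_form l c t) (homog (lawrence i)) = lawrence_value l c t i.
Proof.
rewrite dotv_homog; case: i => [[i|[j b]]|] /=.
- by rewrite dotv_row_mx dotv0r addr0.
- by rewrite dotv_row_mx dotvZr dotv_deltar mxE addrA subrK.
- by rewrite dotv0r add0r.
Qed.

Lemma sign_mulr_ge (b : bool) (x : R) : 0 <= (-1) ^+ b * x + `|x|.
Proof. by case: b; rewrite ?expr1 ?expr0 ?mulN1r ?mul1r; have := ler_norm x; have := ler_norm (- x); rewrite normrN; lra. Qed.

Lemma lawrence_value_ge0 l c t : 0 <= t -> (forall i, 0 <= dotv l (p i) + t) ->
  (forall j, `|dotv l (r j)| <= c j) -> forall i, 0 <= lawrence_value l c t i.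
Proof.
move=> t0 lp lc [[i|[j b]]|] //=.
by apply: le_trans (sign_mulr_ge b (dotv l (r j))) _; rewrite lerD2l.
Qed.

Section NormalForm.
(** [X] stands for the homogenized vertices of a realization, and [trX] for what the isomorphism of
    face lattices yields. *)
Variable X : lawrence_index -> 'rV[R]_(k + N + 1).
Hypothesis trX : forall l c t, (forall i, 0 <= lawrence_value l c t i) ->
  exists L, forall i, 0 <= dotv L (X i) /\ (dotv L (X i) = 0 <-> lawrence_value l c t i = 0).
Variable e : 'I_k -> 'I_N.
Hypothesis eP : forall a, r (e a) = delta_mx 0 a.

Let Xo := X None.
Let Xp i := X (Some (inl i)).
Let Xr j b := X (Some (inr (j, b))).

Lemma lawrence_height_form : exists H,
  [/\ 0 < dotv H Xo, forall i, 0 < dotv H (Xp i) & forall j b, dotv H (Xr j b) = 0].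
Proof.
have [|H hH] := trX (l := 0) (c := fun=> 0) (t := 1).
  by apply: lawrence_value_ge0 => // *; rewrite dotv0l ?add0r ?normr0.
exists H; split=> [|i|j b].
- by have [h0 h1] := hH None; rewrite lt_def h0 andbT; apply/eqP => /h1 /eqP; rewrite oner_eq0.
- have [h0 h1] := hH (Some (inl i)); rewrite lt_def h0 andbT; apply/eqP => /h1 /eqP.
  by rewrite /= dotv0l add0r oner_eq0.
- by have [h0 h1] := hH (Some (inr (j, b))); apply/h1; rewrite /= dotv0l mulr0 addr0.
Qed.

Lemma lawrence_pair_form j : exists G,
  [/\ dotv G Xo = 0, forall i, dotv G (Xp i) = 0, forall b, 0 < dotv G (Xr j b)
    & forall j' b, j' != j -> dotv G (Xr j' b) = 0].
Proof.
have [|G hG] := trX (l := 0) (c := fun j' => (j' == j)%:R) (t := 0).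
  by apply: lawrence_value_ge0 => // *; rewrite dotv0l ?add0r ?normr0 ?ler0n.
exists G; split=> [|i|b|j' b jj].
- by apply/(hG None).2.
- by apply/(hG (Some (inl i))).2; rewrite /= dotv0l add0r.
- have [h0 h1] := hG (Some (inr (j, b))); rewrite lt_def h0 andbT; apply/eqP => /h1 /eqP.
  by rewrite /= dotv0l mulr0 add0r eqxx oner_eq0.
- by apply/(hG (Some (inr (j', b)))).2; rewrite /= dotv0l mulr0 add0r (negPf jj).
Qed.

(** The forms [H] and [G j] play the roles of the coordinates [h] and [y_j] on the realization. Once
    each pair is scaled to [G j = 1], half its sum and half its difference replace the lifting
    vector and the direction. *)
Lemma lawrence_normal_form : exists (B : 'M[R]_(k + N + 1)) (rho : 'I_N -> 'rV[R]_k)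
    (q : 'I_n -> 'rV[R]_k) (h : 'I_n -> R) (g : 'I_N -> bool -> R),
  [/\ B \in unitmx, Xo = row_mx 0 1%:M *m B,
      forall i, 0 < h i /\ Xp i = row_mx (row_mx (q i) 0) (h i)%:M *m B,
      forall j b, 0 < g j b /\
        Xr j b = g j b *: (row_mx (row_mx ((-1) ^+ b *: rho j) (delta_mx 0 j)) 0 *m B)
    & forall a, rho (e a) = delta_mx 0 a].
Proof.
have [H [Ho Hp Hr]] := lawrence_height_form.
have /choice[G hG] := lawrence_pair_form.
have Go j : dotv (G j) Xo = 0 by case: (hG j).
have Gp j i : dotv (G j) (Xp i) = 0 by case: (hG j).
have Gr j b : 0 < dotv (G j) (Xr j b) by case: (hG j).
have Gr0 j j' b : j' != j -> dotv (G j) (Xr j' b) = 0 by case: (hG j) => _ _ _; apply.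
pose g j b := dotv (G j) (Xr j b); pose Y j b := (g j b)^-1 *: Xr j b.
have g0 j b : 0 < g j b by exact: Gr.
have GY j j' b : dotv (G j) (Y j' b) = (j' == j)%:R.
  rewrite dotvZr; have [->|jj] := eqVneq j' j; first by rewrite -/(g j b) mulVf // gt_eqF.
  by rewrite Gr0 ?mulr0.
have HY j b : dotv H (Y j b) = 0 by rewrite dotvZr Hr mulr0.
pose m j := 2^-1 *: (Y j false + Y j true); pose v j := 2^-1 *: (Y j false - Y j true).
have Gm j j' : dotv (G j) (m j') = (j' == j)%:R by rewrite dotvZr dotvDr !GY; field.
have Gv j j' : dotv (G j) (v j') = 0 by rewrite dotvZr dotvBr !GY subrr mulr0.
have Hm j : dotv H (m j) = 0 by rewrite dotvZr dotvDr !HY addr0 mulr0.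
have Hv j : dotv H (v j) = 0 by rewrite dotvZr dotvBr !HY subr0 mulr0.
pose B : 'M[R]_(k + N + 1) := col_mx (col_mx (\matrix_a v (e a)) (\matrix_j m j)) Xo.
have dotB F x y z : dotv F (row_mx (row_mx x y) z%:M *m B) =
    \sum_a x 0 a * dotv F (v (e a)) + \sum_j y 0 j * dotv F (m j) + z * dotv F Xo.
  rewrite !mul_row_col mul_scalar_mx !dotvDr dotvZr !mulmx_sum_row !dotv_sumr.
  by congr (_ + _ + _); apply: eq_bigr => i _; rewrite dotvZr rowK.
have split3 (u : 'rV[R]_(k + N + 1)) : exists x y z, u = row_mx (row_mx x y) z%:M.
  exists (lsubmx (lsubmx u)), (rsubmx (lsubmx u)), (rsubmx u 0 0).
  by rewrite -mx11_scalar !hsubmxK.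
have GB j x y z : dotv (G j) (row_mx (row_mx x y) z%:M *m B) = y 0 j.
  rewrite dotB Go mulr0 addr0 big1 => [|a _]; last by rewrite Gv mulr0.
  rewrite add0r (bigD1 j) //= Gm eqxx mulr1 big1 ?addr0 // => j' jj.
  by rewrite Gm (negPf jj) mulr0.
have HB x y z : dotv H (row_mx (row_mx x y) z%:M *m B) = z * dotv H Xo.
  by rewrite dotB !big1 ?add0r // => a _; rewrite ?Hv ?Hm mulr0.
have Bu : B \in unitmx.
  rewrite -row_free_unit; apply: inj_row_free => u.
  have [x [y [z ->]]] := split3 u => uB.
  have y0 : y = 0 by apply/rowP => j; rewrite -(GB j x y z) uB dotv0r mxE.
  have /eqP := HB x y z; rewrite uB dotv0r eq_sym mulf_eq0 (gt_eqF Ho) orbF => /eqP z0.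
  suff x0 : x = 0 by rewrite x0 y0 z0 raddf0 !row_mx0.
  apply/rowP => a; rewrite mxE.
  (* This form vanishes on both points of pair [e b] if [b != a], but on only one if [b = a]; hence
     its counterpart detects the coefficient of [v (e a)]. The choice of [t] makes it nonnegative on
     the base points. *)
  have [|L hL] := trX (l := delta_mx 0 a) (c := fun j => `|dotv (delta_mx 0 a) (r j)|)
      (t := \sum_i `|dotv (delta_mx 0 a) (p i)|).
    apply: lawrence_value_ge0 => //; first exact: sumr_ge0.
    move=> i; rewrite (bigD1 i) //= addrA ler_wpDr ?sumr_ge0 //.
    by have := sign_mulr_ge false (dotv (delta_mx 0 a) (p i)); rewrite expr0 mul1r.
  have Lv b : dotv L (v (e b)) = 0 <-> b != a.
    have := hL (Some (inr (e b, true))); have := hL (Some (inr (e b, false))).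
    rewrite /= !eP !dotv_deltal !mxE eqxx /= expr0 expr1 mul1r mulN1r.
    have g1 := g0 (e b) true; have g2 := g0 (e b) false.
    rewrite /v dotvZr dotvBr !dotvZr -/(g _ _) => -[h1 h2] [h3 h4].
    move: h2 h4; have [ba|ba] := eqVneq b a => h2 h4; last first.
      by split=> // _; rewrite h2.2 ?h4.2 ?mulr0 ?subr0 ?mulr0 ?normr0 ?addr0 ?oppr0.
    split=> // /eqP; move: h2 h4; rewrite /= normr1 addNr => h2 h4.
    rewrite (h4.2 erefl) mulr0 subr0 !mulf_eq0 !invr_eq0 (gt_eqF g2) pnatr_eq0 /= => /eqP/h2/eqP.
    by rewrite paddr_eq0 ?ler01 // oner_eq0.
  have := dotB L x y z; rewrite uB dotv0r y0 z0 mul0r addr0 [X in _ + X]big1 => [|j _]; last first.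
    by rewrite mxE mul0r.
  rewrite addr0 (bigD1 a) //= big1 => [|b ba]; last by rewrite (Lv b).2 ?mulr0.
  rewrite addr0 => /esym/eqP; rewrite mulf_eq0 => /orP[/eqP//|/eqP/Lv].
  by rewrite eqxx.
pose rho j := lsubmx (lsubmx (v j *m invmx B)).
have vB j : v j = row_mx (row_mx (rho j) 0) 0 *m B.
  have [x [y [z vE]]] := split3 (v j *m invmx B).
  have vE' : v j = row_mx (row_mx x y) z%:M *m B by rewrite -vE mulmxKV.
  have y0 : y = 0 by apply/rowP => j'; rewrite -(GB j' x y z) -vE' Gv mxE.
  have /eqP := HB x y z; rewrite -vE' Hv eq_sym mulf_eq0 (gt_eqF Ho) orbF => /eqP z0.
  by rewrite /rho vE !row_mxKl [LHS]vE' y0 z0 raddf0.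
have mB j : m j = row_mx (row_mx 0 (delta_mx 0 j)) 0 *m B.
  by rewrite !mul_row_col !mul0mx add0r addr0 -rowE rowK.
have /choice[q /choice[h hq]] i : exists q h, 0 < h /\ Xp i = row_mx (row_mx q 0) h%:M *m B.
  have [x [y [z vE]]] := split3 (Xp i *m invmx B).
  have vE' : Xp i = row_mx (row_mx x y) z%:M *m B by rewrite -vE mulmxKV.
  have y0 : y = 0 by apply/rowP => j'; rewrite -(GB j' x y z) -vE' Gp mxE.
  exists x, z; split; last by rewrite vE' y0.
  by have := Hp i; rewrite vE' HB pmulr_lgt0.
exists B, rho, q, h, g; split=> // [|j b|a].
- by rewrite mul_row_col mul0mx add0r mul1mx.
- split; first exact: Gr.
  have -> : row_mx (row_mx ((-1) ^+ b *: rho j) (delta_mx 0 j)) 0 *m B = m j + (-1) ^+ b *: v j.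
    by rewrite vB mB scalemxAl -mulmxDl !scale_row_mx !add_row_mx !scaler0 !addr0 !add0r.
  have -> : m j + (-1) ^+ b *: v j = Y j b.
    rewrite /m /v; case: b; rewrite ?expr1 ?expr0 ?scaleN1r ?scale1r -?scalerBr -?scalerDr.
      by rewrite opprB addrC addrA subrK -mulr2n -scaler_nat scalerA mulVf ?scale1r ?pnatr_eq0.
    by rewrite addrACA subrr addr0 -mulr2n -scaler_nat scalerA mulVf ?scale1r ?pnatr_eq0.
  by rewrite /Y scalerA divff ?scale1r // gt_eqF.
- have : v (e a) = row_mx (row_mx (delta_mx 0 a) 0) 0 *m B.
    by rewrite !mul_row_col !mul0mx !addr0 -rowE rowK.
  by rewrite /rho => ->; rewrite mulmxK // !row_mxKl.
Qed.

End NormalForm.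

Hypothesis r_neq0 : forall j, r j != 0.
Variable l0 : 'rV[R]_k.
Hypothesis l0p : forall i, dotv l0 (p i) = 1.

Lemma lawrence_exposed i l c t : (forall j, 0 <= lawrence_value l c t j) ->
  lawrence_value l c t i = 0 ->
  (forall j, lawrence_value l c t j = 0 -> lawrence j = lawrence i) ->
  vertex (hull lawrence) (lawrence i).
Proof.
move=> ge0 i0 eqi; pose F := lawrence_form l c t.
have vE j : dotv (- lsubmx F) (lawrence j) = t - lawrence_value l c t j.
  by rewrite -lawrence_formE homog_dotv dotvNl row_mxKr mxE eqxx mulr1n opprD addrCA subrr addr0.
apply: (exposed_vertex (a := - lsubmx F)) => j; rewrite !vE i0 subr0.
  by rewrite gerBl.
by move=> e; apply: eqi; apply/eqP; rewrite -oppr_eq0 -(inj_eq (addrI t)) e addr0.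
Qed.

Lemma lawrence_vertex i :
  (forall i, exists l, dotv l (p i) = 0 /\ forall j, 0 <= dotv l (p j) /\ (dotv l (p j) = 0 -> p j = p i)) ->
  vertex (hull lawrence) (lawrence i).
Proof.
move=> hp; case: i => [[i|[j b]]|].
- have [l [li lj]] := hp i.
  (* Trading [l0] for the constant 1 preserves the values on the base points and lifts the apex to
     1. *)
  have vE j : dotv (l - l0) (p j) + 1 = dotv l (p j) by rewrite dotvBl l0p subrK.
  apply: (@lawrence_exposed _ (l - l0) (fun j => `|dotv (l - l0) (r j)| + 1) 1).
  + apply: lawrence_value_ge0 => // [j|j]; last by rewrite ler_wpDr.
    by rewrite vE; case: (lj j).
  + by rewrite /= vE.
  + move=> [[j|[j b]]|] /=; last by move/eqP; rewrite oner_eq0.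
      by rewrite vE => /(lj j).2 ->.
    by move=> /eqP; rewrite addrA gt_eqF // ltr_wpDl // sign_mulr_ge.
(* With this [l] the form vanishes at the chosen point and equals twice the squared length of [r j]
   at its partner; [c] and [t] add slack everywhere else. *)
- pose l := - (-1) ^+ b *: r j.
  have lr : dotv l (r j) = - (-1) ^+ b * dotv (r j) (r j) by rewrite dotvZl.
  have rr : 0 < dotv (r j) (r j) by rewrite lt_def dotvv_ge0 dotvv_eq0 r_neq0.
  have nlr : `|dotv l (r j)| = dotv (r j) (r j).
    by rewrite lr normrM normrN normr_sign mul1r gtr0_norm.
  pose c j' := `|dotv l (r j')| + (j' != j)%:R; pose t := 1 + \sum_i `|dotv l (p i)|.
  have t0 i : 0 < dotv l (p i) + t.
    rewrite /t addrCA ltr_pwDl // (bigD1 i) //= addrA addr_ge0 ?sumr_ge0 //.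
    by have := sign_mulr_ge false (dotv l (p i)); rewrite expr0 mul1r.
  have t1 : 0 < t by rewrite ltr_pwDl // sumr_ge0.
  apply: (@lawrence_exposed _ l c t).
  + apply: lawrence_value_ge0 => [|i|j']; [exact: ltW|exact: ltW|].
    by rewrite lerDl ler0n.
  + by rewrite /= /c nlr eqxx addr0 lr mulrA mulrN -expr2 sqrr_sign mulN1r addNr.
  + move=> [[i|[j' b']]|] /=; [by move/eqP; rewrite gt_eqF| |by move/eqP; rewrite gt_eqF].
    rewrite /c; have [->|jj] := eqVneq j' j; last first.
      by move=> /eqP; rewrite addrA gt_eqF // ltr_wpDl // sign_mulr_ge.
    rewrite /= addr0 nlr lr; have [->//|bb] := eqVneq b' b.
    have -> : b' = ~~ b by case: b b' bb {l lr nlr c t t0 t1} => [] [].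
    rewrite signrN mulrA mulNr mulrN opprK -expr2 sqrr_sign mul1r => /eqP.
    by rewrite -mulr2n mulrn_eq0 (gt_eqF rr).
- apply: (@lawrence_exposed _ l0 (fun j => `|dotv l0 (r j)| + 1) 0).
  + by apply: lawrence_value_ge0 => // [j|j]; [rewrite l0p addr0 ler01|rewrite ler_wpDr].
  + by [].
  + move=> [[j|[j b]]|] //=; first by rewrite l0p addr0 => /eqP; rewrite oner_eq0.
    by move=> /eqP; rewrite addrA gt_eqF // ltr_wpDl // sign_mulr_ge.
Qed.

Definition lawrence_base i := lawrence (Some (inl i)).

(** The form with [l = - l0] and [t = 1] vanishes on the base; it is 1 at the apex and at least 1 on
    every pair. *)
Lemma lawrence_face : face (hull lawrence) (hull lawrence_base).
Proof.
pose c j := `|dotv (- l0) (r j)| + 1.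
have v0 : forall i, 0 <= lawrence_value (- l0) c 1 i.
  apply: lawrence_value_ge0 => // [j|j]; first by rewrite dotvNl l0p addNr.
  by rewrite ler_wpDr.
pose F := lawrence_form (- l0) c 1.
have vE j : dotv (- lsubmx F) (lawrence j) = 1 - lawrence_value (- l0) c 1 j.
  by rewrite -lawrence_formE homog_dotv dotvNl row_mxKr mxE eqxx mulr1n opprD addrCA subrr addr0.
have le1 j : dotv (- lsubmx F) (lawrence j) <= 1 by rewrite vE gerBl.
exists (- lsubmx F), 1; split=> [x [l [lg0 [l1 ->]]]|]; first exact: dotv_hull_le.
apply/seteqP; split=> [x hx|_ [[l [lg0 [l1 ->]]] /(dotv_hull_eq le1 lg0 l1) h]].
  split; first by apply: hull_sub hx => i; exact: mem_hull.
  have [l [lg0 [l1 ->]]] := hx; rewrite /= dotv_sumr -l1; apply: eq_bigr => i _.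
  by rewrite dotvZr vE /= dotvNl l0p addNr subr0 mulr1.
apply: hull_comb => // -[[i|[j b]]|] /h; rewrite vE /=; first by move=> _; exact: mem_hull.
  move=> /eqP; rewrite -subr_eq0 addrAC subrr add0r oppr_eq0 addrA gt_eqF //.
  by rewrite ltr_wpDl // sign_mulr_ge.
by move=> /eqP; rewrite subrr eq_sym oner_eq0.
Qed.

End Lawrence.

(** * Rigidity of the Lawrence polytope of a rigid list *)

Section LawrenceRigidity.
Variables (R : realType) (d n : nat).
Notation k := (5 + d)%N.
Notation vec := 'rV[R]_k.
Notation i0 := (@Ordinal k 0 isT).
Notation i2 := (@Ordinal k 2 isT).
Variables (p : 'I_n -> vec) (L : seq vec).
Hypotheses (rigidL : rigid L) (frameL : {subset frame R d <= L}) (uniqL : uniq L).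
Hypothesis p0 : forall i, p i 0 i0 = 1.
(** Each [E i b] defines a face of the base through [p i]. As its coefficient at coordinate 2 is 1,
    the vectors in [EL] span its kernel; the forms for varying [b] leave only the line of [p i]. *)
Variable E : 'I_n -> 'I_k -> vec.
Hypothesis E2 : forall i b, E i b 0 i2 = 1.
Hypothesis Ep : forall i b, dotv (E i b) (p i) = 0.
Hypothesis Ep_ge0 : forall i b j, 0 <= dotv (E i b) (p j).
Hypothesis EL : forall i b c, c != i2 ->
  (delta_mx 0 c + (- E i b 0 c) *: delta_mx 0 i2 : vec) \in L.
Hypothesis Eline : forall i q, (forall b, dotv (E i b) q = 0) -> q = q 0 i0 *: p i.

Let N := size L.
Let r (j : 'I_N) : vec := L`_j.

Let idx v : v \in L -> 'I_N := fun h => Ordinal (etrans (index_mem v L) h).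

Let idxE v (h : v \in L) : r (idx h) = v.
Proof. by rewrite /r /= nth_index. Qed.

Let deltaL a : (delta_mx 0 a : vec) \in L.
Proof. by apply: frameL; exact: delta_frame. Qed.

Let oneL : (const_mx 1 : vec) \in L.
Proof. by apply: frameL; exact: mem_head. Qed.

Lemma lawrence_rigid (X : lawrence_index n N -> 'rV[R]_(k + N + 1)) :
  (forall l c t, (forall i, 0 <= lawrence_value p r l c t i) -> exists F, forall i,
    0 <= dotv F (X i) /\ (dotv F (X i) = 0 <-> lawrence_value p r l c t i = 0)) ->
  exists2 M : 'M[R]_(k + N + 1), M \in unitmx & exists mu : lawrence_index n N -> R,
    forall i, 0 < mu i /\ X i = mu i *: (homog (lawrence p r i) *m M).
Proof.
move=> trX.
have [B [rho [q [h [g [Bu Xo Xp Xr rhoe]]]]]] :=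
  lawrence_normal_form trX (fun a => idxE (deltaL a)).
have h0 i : 0 < h i by case: (Xp i).
have g0 j b : 0 < g j b by case: (Xr j b).
(* Forms valid on [lawrence] induce forms on [rho], [q] with the same signs. *)
have tr l t : 0 <= t -> (forall i, 0 <= dotv l (p i) + t) -> exists (l' : vec) (t' : R),
    [/\ forall j, Num.sg (dotv l' (rho j)) = Num.sg (dotv l (r j)),
        0 <= t' /\ (t' = 0 <-> t = 0) &
        forall i, 0 <= dotv l' (q i) + t' * h i /\
          (dotv l' (q i) + t' * h i = 0 <-> dotv l (p i) + t = 0)].
  move=> t0 lp; have [|F hF] := trX l (fun j => `|dotv l (r j)|) t; first exact: lawrence_value_ge0.
  pose F' := F *m B^T; pose l' := lsubmx (lsubmx F'); pose c' := rsubmx (lsubmx F').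
  pose t' := rsubmx F' 0 0.
  have FE x y z : dotv F (row_mx (row_mx x y) z%:M *m B) = dotv l' x + dotv c' y + t' * z.
    rewrite dotv_mulmx -/F' -[F']hsubmxK -[lsubmx F']hsubmxK !dotv_row_mx; congr (_ + _).
    by rewrite /dotv big_ord1 [z%:M _ _]mxE eqxx mulr1n.
  exists l', t'; split=> [j||i].
  - have hb b := hF (Some (inr (j, b))).
    have Fb b : dotv F (X (Some (inr (j, b)))) = g j b * ((-1) ^+ b * dotv l' (rho j) + c' 0 j).
      have [_ ->] := Xr j b; rewrite dotvZr -[X in row_mx _ X](raddf0 (@scalar_mx _ _)) FE.
      by rewrite mulr0 addr0 dotvZr dotv_deltar.
    have {hb} hb (b : bool) : 0 <= (-1) ^+ b * dotv l' (rho j) + c' 0 j /\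
        ((-1) ^+ b * dotv l' (rho j) + c' 0 j = 0 <-> (-1) ^+ b * dotv l (r j) + `|dotv l (r j)| = 0).
      have := hb b; rewrite Fb pmulr_rge0 //= => -[-> hb0]; split=> //; rewrite -hb0.
      by split=> [->|/eqP]; [rewrite mulr0|rewrite mulf_eq0 gt_eqF //= => /eqP].
    have [] := hb false; have [] := hb true; rewrite expr0 expr1 !mul1r !mulN1r.
    (* The point of the pair where the original form vanishes determines [c' 0 j], and the other
       point then gives the sign of [l'] on [rho j]. *)
    have [lr|lr|->] := ltrgt0P (dotv l (r j)).
    + rewrite addNr => h1 [_ /(_ erefl) e1] h2 [n2 _].
      rewrite (gtr0_sg lr) gtr0_sg //.
      have : dotv l' (rho j) + c' 0 j != 0 by apply/eqP => /n2; lra.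
      by move: h2; rewrite le_eqVlt eq_sym => /orP[->//|]; lra.
    + rewrite addrN => h1 [n1 _] h2 [_ /(_ erefl) e2].
      rewrite (ltr0_sg lr) ltr0_sg //.
      have : - dotv l' (rho j) + c' 0 j != 0 by apply/eqP => /n1; lra.
      by move: h1; rewrite le_eqVlt eq_sym => /orP[->//|]; lra.
    + rewrite oppr0 addr0 => h1 [_ /(_ erefl) e1] h2 [_ /(_ erefl) e2].
      have -> : dotv l' (rho j) = 0 by lra.
      by rewrite sgr0.
  - by have := hF None; rewrite Xo -[X in row_mx X _]row_mx0 FE !dotv0r !add0r mulr1.
  - have := hF (Some (inl i)); have [_ Xi] := Xp i.
    by rewrite Xi FE dotv0r addr0.
have tr0 l : exists l', forall j, Num.sg (dotv l' (rho j)) = Num.sg (dotv l (r j)).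
  have [||l' [t' [sl _ _]]] := tr l (\sum_i `|dotv l (p i)|); [exact: sumr_ge0| |by exists l'].
  move=> i; rewrite (bigD1 i) //= addrA addr_ge0 ?sumr_ge0 //.
  by have := sign_mulr_ge false (dotv l (p i)); rewrite expr0 mul1r.
have sgdelta l l' : (forall j, Num.sg (dotv l' (rho j)) = Num.sg (dotv l (r j))) ->
    forall a, Num.sg (l' 0 a) = Num.sg (l 0 a).
  by move=> sl a; have := sl (idx (deltaL a)); rewrite rhoe idxE !dotv_deltar.
(* Rescaling by [c] sends the image of the all-ones vector to itself. *)
pose c a := rho (idx oneL) 0 a.
have c0 a : 0 < c a.
  have [l' sl] := tr0 (delta_mx 0 a); have sd := sgdelta _ _ sl.
  have := sl (idx oneL); rewrite idxE dotv_deltal mxE sgr1.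
  rewrite /dotv (bigD1 a) //= big1 => [|b ba]; last first.
    by have /eqP := sd b; rewrite mxE (negPf ba) andbF sgr0 sgr_eq0 => /eqP->; rewrite mul0r.
  by rewrite addr0 sgrM sd mxE !eqxx sgr1 mul1r => /eqP; rewrite sgr_cp0.
(* [rho] is indexed by positions, while rigidity concerns maps on vectors; [uniqL] makes the two
   views agree. Outside [L] the value 0 is a dummy. *)
pose rh v : vec := if pselect (v \in L) is left vL then \row_a (rho (idx vL) 0 a / c a) else 0.
have rhE j : rh (r j) = \row_a (rho j 0 a / c a).
  rewrite /rh; case: pselect => [vL|[]]; last by apply: mem_nth.
  have -> : idx vL = j by apply: val_inj; rewrite /= index_uniq.
  by [].
have rhL v (vL : v \in L) : rh v = \row_a (rho (idx vL) 0 a / c a).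
  by rewrite -rhE idxE.
have norm_rh : normalized L rh.
  split=> [l|v].
    have [l' sl] := tr0 l; exists (\row_a (l' 0 a * c a)) => v.
    rewrite mem_cat => vL; have {}vL : v \in L by case/orP: vL => // /frameL.
    have <- := idxE vL; rewrite -sl rhE; congr Num.sg; apply: eq_bigr => a _.
    by rewrite !mxE; field; exact: lt0r_neq0.
  rewrite inE => /orP[/eqP->|/mapP[a _ ->]].
    exists 1 => //; rewrite (rhL _ oneL); apply/rowP => a; rewrite !mxE mulr1 divff //; exact: lt0r_neq0.
  exists (c a)^-1; first by rewrite invr_gt0.
  rewrite (rhL _ (deltaL a)) rhoe; apply/rowP => b; rewrite !mxE.
  by have [->|] := eqVneq b a; rewrite ?andbF ?mul0r ?mulr0 // mulrC.
have /choice[la hla] j : exists la : R, 0 < la /\ forall a, rho j 0 a = c a * (la * r j 0 a).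
  have [la la0 rla] := rigidL norm_rh (mem_nth 0 (ltn_ord j)).
  exists la; split=> // a; have := congr1 (fun v : vec => v 0 a) rla.
  by rewrite rhE !mxE => <-; rewrite mulrC divfK // gt_eqF.
(* A valid form [E i b] has its kernel spanned by fixed directions, so it is preserved. *)
have [s s0 qE] : exists2 s, 0 < s & forall i a, q i 0 a = h i * (c a * (s * p i 0 a)).
  (* The form [h - x_0] vanishes on every base point but not at the apex. Its counterpart ties
     coordinate 0 of each [q i] to [h i] by a single factor [s]. *)
  have [||l' [t' [sl [t'0 t'1] hq]]] := tr (- delta_mx 0 i0) 1.
  - exact: ler01.
  - by move=> i; rewrite dotvNl dotv_deltal p0 addNr.
  have sd := sgdelta _ _ sl.
  have l'0 : l' 0 i0 < 0 by rewrite -sgr_lt0 sd !mxE eqxx sgrN sgr1; lra.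
  have l'a a : a != i0 -> l' 0 a = 0.
    by move=> ai; have /eqP := sd a; rewrite !mxE (negPf ai) oppr0 sgr0 sgr_eq0 => /eqP.
  have t'gt0 : 0 < t'.
    by rewrite lt_def t'0 andbT; apply/eqP => /t'1 /eqP; rewrite oner_eq0.
  pose s := t' / (- l' 0 i0) / c i0; exists s; first by rewrite !divr_gt0 ?oppr_gt0 ?c0.
  have q0 i : q i 0 i0 = h i * (s * c i0).
    have := (hq i).2.2; rewrite dotvNl dotv_deltal p0 addNr => /(_ erefl).
    rewrite /dotv (bigD1 i0) //= big1 => [|a ai]; last by rewrite l'a ?mul0r.
    rewrite addr0 /s divfK ?(gt_eqF (c0 _)) // => e.
    have l'n : - l' 0 i0 != 0 by rewrite oppr_eq0 lt_eqF.
    by apply: (mulIf l'n); rewrite mulrA divfK //; lra.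
  move=> i; pose v : vec := \row_a (q i 0 a / c a).
  have Ev b : dotv (E i b) v = 0.
    have [||m [u [sm [_ u0] hm]]] := tr (E i b) 0; [by []|by move=> j; rewrite addr0|].
    have u00 : u = 0 by apply/u0.
    have := (hm i).2.2; rewrite Ep addr0 u00 mul0r addr0 => /(_ erefl) mq.
    pose m' : vec := \row_a (m 0 a * c a).
    have m'2 : 0 < m' 0 i2.
      by rewrite mxE mulr_gt0 ?c0 // -sgr_gt0 (sgdelta _ _ sm) E2 sgr1.
    have m'r j : dotv m (rho j) = la j * dotv m' (r j).
      rewrite /dotv mulr_sumr; apply: eq_bigr => a _; have [_ ->] := hla j.
      by rewrite mxE; ring.
    have m'E : m' = m' 0 i2 *: E i b.
      apply/rowP => a; rewrite [RHS]mxE; have [->|a2] := eqVneq a i2; first by rewrite E2 mulr1.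
      have := sm (idx (EL i b a2)); rewrite m'r idxE !dotvDr !dotvZr !dotv_deltar E2 mulr1.
      rewrite addrN sgr0 => /eqP; rewrite sgr_eq0 mulf_eq0 gt_eqF /=; last by case: (hla (idx (EL i b a2))).
      by rewrite mulNr subr_eq0 mulrC => /eqP.
    have : dotv m' v = 0.
      rewrite -mq; apply: eq_bigr => a _; rewrite !mxE; field; exact: lt0r_neq0.
    by rewrite m'E dotvZl => /eqP; rewrite mulf_eq0 (gt_eqF m'2) /= => /eqP.
  move=> a; have /(congr1 (fun w : vec => w 0 a)) := Eline Ev.
  rewrite !mxE q0 => e.
  by rewrite -[LHS](divfK (lt0r_neq0 (c0 a))) e; field; exact: lt0r_neq0.
pose cm : 'rV[R]_k := \row_a c a; pose lm : 'rV[R]_N := \row_j (la j)^-1.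
have la0 j : 0 < la j by case: (hla j).
(* [C] passes to the coordinates [(x, y, h)] with [h = 1 - sum y] and scales them by [c], the
   inverses of [la], and the inverse of [s]. *)
pose C : 'M[R]_(k + N + 1) :=
  block_mx (block_mx (diag_mx cm) 0 0 (diag_mx lm)) (col_mx 0 (const_mx (- s^-1))) 0 s^-1%:M.
have CE (x : vec) (y : 'rV[R]_N) (z : R) : row_mx (row_mx x y) z%:M *m C =
    row_mx (row_mx (\row_a (c a * x 0 a)) (\row_j (y 0 j / la j))) ((z - \sum_j y 0 j) / s)%:M.
  rewrite mul_row_block mulmx0 addr0 mul_row_block !mulmx0 addr0 add0r mul_row_col mulmx0 add0r.
  rewrite !mul_mx_diag; congr (row_mx (row_mx _ _) _).
  - by apply/rowP => a; rewrite !mxE mulrC.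
  - by apply/rowP => j; rewrite !mxE.
  apply/rowP => j; rewrite !ord1 mul_scalar_mx !mxE eqxx !mulr1n mulrBl addrC; congr (_ + _).
  by rewrite mulr_suml -sumrN; apply: eq_bigr => j' _; rewrite mxE mulrN.
exists (C *m B).
  rewrite unitmx_mul Bu andbT unitmxE !det_ublock !det_diag unitfE !mulf_neq0 //.
  - by apply/prodf_neq0 => a _; rewrite mxE gt_eqF.
  - by apply/prodf_neq0 => a _; rewrite mxE invr_eq0 gt_eqF.
  - by rewrite det_scalar1 invr_eq0 gt_eqF.
exists (fun i => match i with
  | None => s | Some (inl i) => h i * s | Some (inr (j, b)) => g j b * la j end).
move=> [[i|[j b]]|]; rewrite mulmxA.
- split; first exact: mulr_gt0.
  have [_ ->] := Xp i; rewrite /homog /= (_ : 1 = 1%:M) // CE scalemxAl; congr (_ *m _).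
  rewrite !scale_row_mx scale_scalar_mx; congr (row_mx (row_mx _ _) _%:M).
  + by apply/rowP => a; rewrite !mxE qE; ring.
  + by apply/rowP => j; rewrite !mxE mul0r mulr0.
  + rewrite big1 => [|j _]; last by rewrite mxE.
    by field; exact: lt0r_neq0.
- split; first exact: mulr_gt0.
  have [_ ->] := Xr j b; rewrite /homog /= (_ : 1 = 1%:M) // CE !scalemxAl; congr (_ *m _).
  rewrite !scale_row_mx; congr (row_mx (row_mx _ _) _).
  + by apply/rowP => a; rewrite !mxE; have [_ ->] := hla j; ring.
  + by apply/rowP => j'; rewrite !mxE eqxx /=; have [->|_] := eqVneq j' j;
      rewrite ?mul0r ?mulr0 //; field; exact: lt0r_neq0.
  + rewrite (bigD1 j) //= mxE !eqxx big1 => [|j' jj]; last by rewrite mxE (negPf jj).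
    by rewrite addr0 subrr mul0r scaler0 [X in _ *: X]raddf0 scaler0.
- split=> //; rewrite Xo /homog /= (_ : 1 = 1%:M) // -{2}[0]row_mx0 CE scalemxAl; congr (_ *m _).
  rewrite -{1}[0]row_mx0 !scale_row_mx scale_scalar_mx; congr (row_mx (row_mx _ _) _%:M).
  + by apply/rowP => a; rewrite !mxE !mulr0.
  + by apply/rowP => j; rewrite !mxE mul0r mulr0.
  + rewrite big1 => [|j _]; last by rewrite mxE.
    by field; exact: lt0r_neq0.
Qed.

End LawrenceRigidity.

(** * Exposing forms with rigid coefficients *)
Section ExposingForms.
Variable R : realType.

(* Round a large multiple of [a]. *)
Lemma integral_exposing_form d n (D : 'I_n -> 'rV[R]_d) (a : 'rV[R]_d) :
  (forall j, D j = 0 \/ 0 < dotv a (D j)) ->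
  exists z : 'I_d -> int, forall j,
    0 <= dotv (\row_i (z i)%:~R) (D j) /\ forall b, `|D j 0 b| <= dotv (\row_i (z i)%:~R) (D j).
Proof.
(* The factor 2 leaves one [S j] for the rounding error, as each coefficient moves by at most 1, and
   one [S j] to dominate all coordinates of [D j]. *)
move=> aD; pose S j := \sum_b `|D j 0 b|; pose t := \sum_j 2 * S j / dotv a (D j).
have S0 j : 0 <= S j by exact: sumr_ge0.
have aD0 j : 0 <= dotv a (D j) by case: (aD j) => [->|/ltW//]; rewrite dotv0r.
exists (fun i => Num.floor (t * a 0 i)) => j.
have [->|aj] := aD j; first by split=> [|b]; rewrite ?mxE ?normr0 dotv0r.
have tS : 2 * S j <= t * dotv a (D j).
  rewrite -ler_pdivrMr // /t (bigD1 j) //= lerDl sumr_ge0 // => i _.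
  by rewrite divr_ge0 ?mulr_ge0.
have rnd : dotv (t *: a - \row_i (Num.floor (t * a 0 i))%:~R) (D j) <= S j.
  apply: ler_sum => i _; apply: le_trans (ler_norm _) _; rewrite normrM ler_piMl //.
  rewrite !mxE ler_norml; have /andP[] := floor_itv (t * a 0 i).
  by rewrite intrD; lra.
have S0j := S0 j; move: rnd; rewrite dotvBl dotvZl => rnd; split=> [|b]; first lra.
have : `|D j 0 b| <= S j by rewrite /S (bigD1 b) //= lerDl sumr_ge0.
by lra.
Qed.

Variable d : nat.
Implicit Types (a x y : 'rV[R]_d).
Notation k := (5 + d)%N.
Notation i0 := (@Ordinal k 0 isT).
Notation i2 := (@Ordinal k 2 isT).

Definition base_vec x : 'rV[R]_k := row_mx (delta_mx 0 0) x.

Lemma base_vec0 x : base_vec x 0 i0 = 1.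
Proof.
have -> : i0 = lshift d ord0 by exact: val_inj.
by rewrite row_mxEl mxE.
Qed.

Lemma base_vec2 x : base_vec x 0 i2 = 0.
Proof.
have -> : i2 = lshift d (@Ordinal 5 2 isT) by exact: val_inj.
by rewrite row_mxEl mxE.
Qed.

Definition exposing_form a x : 'rV[R]_k := row_mx (- dotv a x *: delta_mx 0 0) a.

Lemma exposing_formE a x y : dotv (exposing_form a x) (base_vec y) = dotv a (y - x).
Proof. by rewrite dotv_row_mx dotvZl dotv_deltal mxE mulr1 dotvBr addrC. Qed.

(* For varying [b] these forms cut out the line through [base_vec x]; the coefficient 1
   at the coordinate 2, where base vectors vanish, serves as a common scale. *)
Definition line_form a x (b : 'I_k) : 'rV[R]_k :=
  delta_mx 0 i2 + (if b == i2 then 0 else delta_mx 0 b - base_vec x 0 b *: delta_mx 0 i0)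
    + exposing_form a x.

Lemma line_formE a x b q : dotv (line_form a x b) q =
  q 0 i2 + (if b == i2 then 0 else q 0 b - base_vec x 0 b * q 0 i0) + dotv (exposing_form a x) q.
Proof.
rewrite !dotvDl dotv_deltal; case: ifP => _; first by rewrite dotv0l.
by rewrite dotvBl dotvZl !dotv_deltal.
Qed.

Lemma line_form2 a x b : line_form a x b 0 i2 = 1.
Proof.
have dE c : (delta_mx 0 i2 : 'rV[R]_k) 0 c = (c == i2)%:R by rewrite mxE.
rewrite -dotv_deltar line_formE !dE eqxx.
have -> : dotv (exposing_form a x) (delta_mx 0 i2) = 0.
  have -> : i2 = lshift d (@Ordinal 5 2 isT) by exact: val_inj.
  by rewrite dotv_deltar row_mxEl !mxE mulr0.
by case: ifP => [_|->]; rewrite ?mulr0 ?subr0 !addr0.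
Qed.

Lemma line_form_base a x b : dotv (line_form a x b) (base_vec x) = 0.
Proof.
rewrite line_formE exposing_formE subrr dotv0r base_vec2 base_vec0 mulr1 subrr.
by case: ifP; rewrite !addr0.
Qed.

(** The value is [a] on [y - x] plus at most one coordinate of [y - x], which the first term
    dominates. *)
Lemma line_form_ge0 a x y b : (forall c, `|(y - x) 0 c| <= dotv a (y - x)) ->
  0 <= dotv a (y - x) -> 0 <= dotv (line_form a x b) (base_vec y).
Proof.
move=> ha a0; rewrite line_formE exposing_formE base_vec2 base_vec0 mulr1 add0r.
case: ifP => _; first by rewrite add0r.
case: (splitP b) => [c bc|c bc].
  have -> : b = lshift d c by exact: val_inj.
  by rewrite !row_mxEl subrr add0r.
have -> : b = rshift 5 c by exact: val_inj.
rewrite !row_mxEr; have := ha c; rewrite ler_norml !mxE; lra.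
Qed.

(** Subtracting the equation for [b = i2] from the others fixes every coordinate except 2. Exposing
    forms ignore coordinate 2, so they vanish on [q], and the equation for [i2] then gives
    [q 0 i2 = 0]. *)
Lemma line_form_line a x q : (forall b, dotv (line_form a x b) q = 0) ->
  q = q 0 i0 *: base_vec x.
Proof.
move=> h; pose f := exposing_form a x.
have h2 : q 0 i2 + dotv f q = 0 by have := h i2; rewrite line_formE eqxx addr0.
have hb b : b != i2 -> q 0 b = q 0 i0 * base_vec x 0 b.
  by move=> b2; have := h b; rewrite line_formE (negPf b2) -/f; move: h2; lra.
have q2 : q 0 i2 = 0.
  move: h2; suff -> : dotv f q = 0 by rewrite addr0.
  have f2 : f 0 i2 = 0.
    have -> : i2 = lshift d (@Ordinal 5 2 isT) by exact: val_inj.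
    by rewrite row_mxEl !mxE mulr0.
  transitivity (q 0 i0 * dotv f (base_vec x)).
    rewrite /dotv mulr_sumr; apply: eq_bigr => b _.
    have [->|b2] := eqVneq b i2; first by rewrite f2 !mul0r mulr0.
    by rewrite hb // mulrCA.
  by rewrite exposing_formE subrr dotv0r mulr0.
apply/rowP => b; rewrite mxE; have [->|] := eqVneq b i2; last exact: hb.
by rewrite q2 base_vec2 mulr0.
Qed.

(** Integrality of [z] makes every coefficient an integer combination of 1 and the coordinates of
    [x]. *)
Lemma rigid_number_line_form (z : 'I_d -> int) x b c : (forall i, algebraic_real (x 0 i)) ->
  rigid_number d (line_form (\row_i (z i)%:~R) x b 0 c).
Proof.
move=> xa.
have ri (m : int) : rigid_number d (m%:~R : R) by exact/rigid_number_algebraic/algebraic_int.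
have rn (m : nat) : rigid_number d (m%:R : R) by exact: (ri m).
have rx i : rigid_number d (x 0 i) by exact: rigid_number_algebraic.
have rb i : rigid_number d (base_vec x 0 i).
  by rewrite mxE; case: split => j //; rewrite mxE; exact: rn.
have rM (w : R) (e : bool) : rigid_number d w -> rigid_number d (w * e%:R).
  by move=> rw; case: e; rewrite ?mulr1 ?mulr0 //; exact: (rn 0%N).
have dE e : (delta_mx 0 c : 'rV[R]_k) 0 e = (e == c)%:R by rewrite mxE.
rewrite -dotv_deltar line_formE !dE dotv_deltar.
apply: rigid_numberD; first apply: rigid_numberD.
- exact: rn.
- case: ifP => _; first exact: (rn 0%N).
  by apply: rigid_numberD; [exact: rn|apply: rigid_numberN; apply: rM].
- rewrite mxE; case: split => j; rewrite !mxE; last exact: ri.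
  apply: rM; apply: rigid_numberN; apply: rigid_number_sum => i.
  by rewrite mxE mulrzl; apply: rigid_numberMz.
Qed.

End ExposingForms.

Section RigidDirections.
Variables (R : realType) (d : nat).

Lemma rigid_undup (L : seq 'rV[R]_(5 + d)) : rigid L -> rigid (undup L).
Proof.
move=> rL rho [tr fr] v; rewrite mem_undup; apply: rL; split=> // l.
by have [l' hl'] := tr l; exists l' => u uL; apply: hl'; rewrite mem_cat mem_undup -mem_cat.
Qed.

Lemma rigid_vec_frame (v : 'rV[R]_(5 + d)) : v \in frame R d -> rigid_vec v.
Proof.
move=> vf; exists [:: v]; last exact: mem_head.
by move=> rho [_ fr] u; rewrite inE => /eqP->; exact: fr.
Qed.

End RigidDirections.

(** * Assembly of the polytope *)

Theorem theorem4p1 (R : realType) (d : nat) (P : set 'rV[R]_d) :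
  algebraic_polytope P ->
  exists (D : nat) (Phat : set 'rV[R]_D),
    polytope Phat /\ proj_unique Phat /\
    exists F : set 'rV[R]_D, face Phat F /\ proj_equiv P F.
Proof.
move=> [pP algP]; have [s [PE sv]] := polytope_vertices pP.
pose n := size s; pose x (i : 'I_n) : 'rV[R]_d := s`_i.
have xv i : vertex P (x i) by apply: sv; exact: mem_nth.
(* A functional exposing a vertex may have arbitrary real coefficients; an integral one keeps the
   coefficients of the line forms rigid. *)
have /choice[z hz] i : exists z : 'I_d -> int, forall j, 0 <= dotv (\row_c (z c)%:~R) (x j - x i) /\
    forall b, `|(x j - x i) 0 b| <= dotv (\row_c (z c)%:~R) (x j - x i).
  have [a [b [ab Fx]]] := xv i.
  have xb : dotv a (x i) = b.
    by have : [set x i] (x i) by []; rewrite Fx => -[].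
  apply: (@integral_exposing_form _ _ _ _ (- a)) => j; rewrite dotvNl dotvBr xb opprB subr_gt0.
  have Pj : P (x j) by rewrite PE; apply: mem_conv; exact: mem_nth.
  have := ab _ Pj; rewrite le_eqVlt => /orP[/eqP e|]; [left|by right].
  have : [set x i] (x j) by rewrite Fx.
  by move=> ->; rewrite subrr.
pose a i : 'rV[R]_d := \row_c (z i c)%:~R.
pose p i := base_vec (x i).
pose i2 := @Ordinal (5 + d) 2 isT.
pose E i b := line_form (a i) (x i) b.
pose dirs := [seq (delta_mx 0 t.2 + (- E t.1.1 t.1.2 0 t.2) *: delta_mx 0 i2 : 'rV[R]_(5 + d)) |
  t in [pred t : 'I_n * 'I_(5 + d) * 'I_(5 + d) | t.2 != i2]].
have [|L0 rL0 sL0] := @rigid_vecs R d (frame R d ++ dirs).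
  move=> v; rewrite mem_cat => /orP[|vd]; first exact: rigid_vec_frame.
  case/fintype.imageP: vd => [[[i b] c]]; rewrite inE /= => c2 ->.
  apply: rigid_vec_pair => //; apply: rigid_numberN; apply: rigid_number_line_form.
  exact: algP.
(* Zeros are removed so that the points of each pair are distinct vertices, repetitions so that a
   direction determines its index. *)
pose L := undup [seq v <- L0 | v != 0].
have rL : rigid L by apply: rigid_undup; exact: rigid_filter.
have memL v : v \in frame R d ++ dirs -> v != 0 -> v \in L.
  by move=> /sL0 vL v0; rewrite mem_undup mem_filter v0.
have frL : {subset frame R d <= L}.
  move=> v vf; apply: memL; first by rewrite mem_cat vf.
  exact: frame_neq0.
pose r (j : 'I_(size L)) := L`_j.
have r0 j : r j != 0.
  by have := mem_nth 0 (ltn_ord j); rewrite -/(r j) mem_undup mem_filter => /andP[].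
have EL i b c : c != i2 ->
    (delta_mx 0 c + (- E i b 0 c) *: delta_mx 0 i2 : 'rV[R]_(5 + d)) \in L.
  move=> c2; apply: memL.
    by rewrite mem_cat; apply/orP; right; apply/fintype.imageP; exists (i, b, c).
  move: (- _) => y; apply/eqP => /rowP/(_ c); rewrite !mxE !eqxx (negPf c2) mulr0 addr0 => /eqP.
  by rewrite oner_eq0.
have Lp i : dotv (delta_mx 0 (@Ordinal (5 + d) 0 isT)) (p i) = 1.
  by rewrite dotv_deltal base_vec0.
have vV i : vertex (hull (lawrence p r)) (lawrence p r i).
  apply: (lawrence_vertex r0 Lp) => j; exists (exposing_form (a j) (x j)).
  rewrite exposing_formE subrr dotv0r; split=> // j'; rewrite exposing_formE.
  have [az hab] := hz j j'; split=> // a0; congr base_vec; apply/eqP; rewrite -subr_eq0.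
  apply/eqP/rowP => b; rewrite [RHS]mxE; apply/eqP; rewrite -normr_le0.
  by have := hab b; rewrite -/(a j) a0.
exists (5 + d + size L)%N, (hull (lawrence p r)); split; first exact: polytope_hull.
split.
  apply: proj_unique_hull => // W hW.
  have [||||||M Mu hM] := @lawrence_rigid R d n p L rL frL (undup_uniq _) _ E _ _ _ EL _ (fun i => homog (W i)).
  - by move=> i; exact: base_vec0.
  - by move=> i b; exact: line_form2.
  - by move=> i b; exact: line_form_base.
  - by move=> i b j; have [az hab] := hz i j; apply: line_form_ge0.
  - by move=> i q; exact: line_form_line.
  - move=> l c t hv; have [|F hF] := hW (lawrence_form l c t).
      by move=> i; rewrite lawrence_formE.
    by exists F => i; rewrite -lawrence_formE.
  - by exists M.
exists (hull (lawrence_base p r)); split; first exact: lawrence_face Lp.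
(* The affine embedding of [y] as [(1, 0, 0, 0, 0, y, 0)], with denominator constantly 1. *)
pose M : 'M[R]_(d + 1, 5 + d + size L + 1) :=
  col_mx (row_mx (row_mx (row_mx 0 1%:M) 0) 0) (row_mx (row_mx (row_mx (delta_mx 0 0) 0) 0) 1%:M).
have ME (y : 'rV[R]_d) (w : R) : row_mx y w%:M *m M =
    row_mx (row_mx (row_mx (w *: delta_mx 0 0) y) 0) w%:M.
  rewrite mul_row_col mul_scalar_mx !mul_mx_row !mulmx0 mulmx1 !scale_row_mx !add_row_mx.
  by rewrite !scaler0 !add0r addr0 scale_scalar_mx mulr1.
have hE y : proj_hom M y = row_mx (row_mx (base_vec y) 0) 1%:M by rewrite /proj_hom ME scale1r.
have dE y : proj_denom M y = 1 by rewrite /proj_denom hE row_mxKr mxE.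
have mE y : proj_map M y = row_mx (base_vec y) 0 by rewrite /proj_map dE hE row_mxKl invr1 scale1r.
have sumE l : \sum_i l i = 1 ->
    \sum_i l i *: lawrence_base p r i = row_mx (base_vec (\sum_i l i *: x i)) 0.
  move=> l1; rewrite -[RHS](row_mxKl _ 1%:M) -hE /proj_hom -/(homog _) -homog_conv //.
  rewrite mulmx_suml linear_sum; apply: eq_bigr => i _.
  by rewrite -scalemxAl linearZ /= -/(proj_hom M (x i)) hE row_mxKl.
exists M; split; last split.
- apply: inj_row_free => u; rewrite -[u]hsubmxK [rsubmx u]mx11_scalar ME => e.
  have w0 : rsubmx u 0 0 = 0.
    by have := congr1 (fun v => rsubmx v 0 0) e; rewrite row_mxKr linear0 !mxE.
  have y0 : lsubmx u = 0.
    by have := congr1 (fun v => rsubmx (lsubmx (lsubmx v))) e; rewrite !row_mxKl row_mxKr !linear0.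
  by rewrite w0 y0 raddf0 row_mx0.
- by move=> y _; rewrite dE oner_eq0.
apply/seteqP; split=> [_ [y Py <-]|y [l [l0 [l1 ->]]]].
  move: Py; rewrite PE convE => -[l [l0 [l1 ->]]].
  by rewrite mE -sumE //; exists l.
exists (\sum_i l i *: x i); last by rewrite mE sumE.
by rewrite PE convE; exists l.
Qed.
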